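(* Let $(P,v,u,w,\tilde H,h)$ be a (sufficiently regular) solution of the coupled model (1)–(5) described in the context, and let $M_{\mathrm{tot}}(t)$ be the total mass of water contained in $\Omega$ at time $t$, i.e. $$M_{\mathrm{tot}}(t)=\rho\int_{\Omega_x}\int_{h(t,x)}^{h_{\mathrm{soil}}(x)}\phi\,s(P)\,dz\,dx+\rho\int_{\Omega_x}\int_{h_{\mathrm{bot}}(x)}^{h(t,x)}\phi\,dz\,dx .$$ Then for all $t\in(0,T)$ $$\frac{\partial}{\partial t}M_{\mathrm{tot}}(t)=-\rho\int_{\Omega_x}(u\cdot e_3)\big|_{\Gamma_{\mathrm{soil}}}\,dx ,$$ where $(u\cdot e_3)|_{\Gamma_{\mathrm{soil}}}$ denotes the trace of $u\cdot e_3$ at $z=h_{\mathrm{soil}}(x)$.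
   Context: Geometry. $\Omega_x\subset\mathbb R^2$ is an open domain with boundary $\partial\Omega_x$ and outward normal $n$ (regarded as a horizontal vector of $\mathbb R^3$); $h_{\mathrm{bot}}<h_{\mathrm{soil}}$ are real functions on $\Omega_x$; $\Omega=\{(x,z):x\in\Omega_x,\ h_{\mathrm{bot}}(x)<z<h_{\mathrm{soil}}(x)\}$; $\Gamma_{\mathrm{soil}}=\{z=h_{\mathrm{soil}}(x)\}$ and $\Gamma_{\mathrm{bot}}=\{z=h_{\mathrm{bot}}(x)\}$ are its upper and lower boundaries. $h_{\max}=h_{\mathrm{soil}}-\delta$ with a small $\delta>0$. $e_3$ is the upward vertical unit vector. Data. $\rho>0$ (density) and $g>0$ (gravity) are constants; $P_s\in\mathbb R$ is a constant; $s=s(P)$ and $k_r=k_r(P)$ are given functions (saturation, relative conductivity) with $s(P)=1\iff P\ge P_s$ and $k_r(P)=1\iff P\ge P_s$; $\phi=\phi(x,z)\in(0,1)$ is the porosity; $K_0(x,z)=\begin{pmatrix}K_{xx}&K_{xz}\\ K_{xz}^T&K_{zz}\end{pmatrix}$ is a $3\times3$ symmetric positive definite tensor with $K_{xx}$ of size $2\times 2$, $K_{zz}$ scalar, $K_{zx}:=K_{xz}^T$. Set $M_0=\begin{pmatrix}S_0&0\\0&0\end{pmatrix}$ with $S_0=K_{xx}-\frac1{K_{zz}}K_{xz}K_{zx}$. $(\alpha,\beta)\in(\mathbb R_+)^2\setminus\{(0,0)\}$; $F$ is a given function on the soil boundary; $P_{\mathrm{init}}$, $H_{\mathrm{init}}$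 are initial data. Notation: $\nabla_x=(\partial_{x_1},\partial_{x_2},0)^T$, $\mathrm{div}_x(v)=\partial_{x_1}v_1+\partial_{x_2}v_2$, and for a function $\tilde H(t,x)$ $$\tilde K(\tilde H)(t,x)=\int_{h_{\mathrm{bot}}(x)}^{h_{\mathrm{soil}}(x)}k_r\big(\rho g(\tilde H(t,x)-z)\big)M_0(x,z)\,dz .$$ For a function $h=h(t,x)$ with $h_{\mathrm{bot}}\le h<h_{\mathrm{soil}}$ set $\Omega_h^-(t)=\{(x,z)\in\Omega: z<h(t,x)\}$, $\Omega_h^+(t)=\{(x,z)\in\Omega: z>h(t,x)\}$, $\Gamma_h=\{z=h(t,x)\}$; $(u\cdot e_3)|_{\Gamma_h^+}$ is the trace of $u\cdot e_3$ on $\Gamma_h$ from above (from $\Omega_h^+$). Coupled model. Unknowns: pressure $P$, velocity $v$, and $u,w,\tilde H=\tilde H(t,x),h=h(t,x)$, such that: (1) In $\Omega_h^+(t)$, $t\in]0,T[$: $\phi\,\partial_t s(P)+\partial_z(u\cdot e_3)=0$; on $]0,T[\times\Gamma_{\mathrm{soil}}$: $\alpha P+\beta\,u\cdot e_3=F$; for $(t,x)\in]0,T[\times\Omega_x$: $P(t,x,h(t,x))=\rho g(\tilde H(t,x)-h(t,x))$ (so $P$ is continuous across $\Gamma_h$); $P(0,\cdot)=P_{\mathrm{init}}$ in $\Omega_h^+(0)$. (2) $P(t,x,z)=\rho g(\tilde H(t,x)-z)$ for $t\in[0,T[$, $(x,z)\in\Omega_h^-(t)$. (3) $\mathrm{div}_x\big(\tilde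 K(\tilde H)\nabla_x\tilde H\big)=(u\cdot e_3)|_{\Gamma_h^+}$ in $]0,T[\times\Omega_x$; $\tilde K(\tilde H)\nabla_x\tilde H\cdot n=0$ on $]0,T[\times\partial\Omega_x$; $\tilde H(0,\cdot)=H_{\mathrm{init}}$ in $\Omega_x$. (4) $h_{\mathrm{bot}}(x)\le h(t,x)\le\max\big\{\min\{\tilde H(t,x)-\frac{P_s}{\rho g},\,h_{\max}(x)\},\,h_{\mathrm{bot}}(x)\big\}$ for $(t,x)\in[0,T[\times\Omega_x$. (5) In $]0,T[\times\Omega$: $v=u+w$, $u=-k_r(P)\big(\frac1{\rho g}\partial_zP+1\big)K_0e_3$, $w=-k_r\big(\rho g(\tilde H-z)\big)M_0\nabla_x\tilde H$. *)

(* Defs.v *)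
From mathcomp Require Import all_boot all_order all_algebra.
From mathcomp Require Import all_classical all_reals all_analysis.

Set Implicit Arguments.
Unset Strict Implicit.
Unset Printing Implicit Defensive.

Import Order.TTheory GRing.Theory Num.Theory.
Import numFieldNormedType.Exports.

Local Open Scope classical_set_scope.
Local Open Scope ring_scope.

(* A horizontal position x is a pair (x_1, x_2) : R * R, a point of the
   subsurface is (x, z) : (R * R) * R, and vectors of R^3 are columns. *)

Section VectorCalculus.
Context {R : realType}.

Definition e3 : 'cV[R]_3 := delta_mx ord_max 0.

Definition dot (u v : 'cV[R]_3) : R := (u^T *m v) 0 0.

(* The library norm on matrices is the sup norm; this is the Euclidean one. *)
Definition enorm (u : 'cV[R]_3) : R := Num.sqrt (dot u u).

Definition partial1 (f : R * R -> R) (x : R * R) : R := 'D_((1, 0) : R * R) f x.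
Definition partial2 (f : R * R -> R) (x : R * R) : R := 'D_((0, 1) : R * R) f x.

Definition grad_x (f : R * R -> R) (x : R * R) : 'cV[R]_3 :=
  \col_(i < 3) [:: partial1 f x; partial2 f x; 0]`_i.

Definition div_x (v : R * R -> 'cV[R]_3) (x : R * R) : R :=
  partial1 (fun y => v y (0 : 'I_3) 0) x
  + partial2 (fun y => v y (1 : 'I_3) 0) x.

(* f is continuously differentiable on the open set A. *)
Definition C1_on (A : set (R * R)) (f : R * R -> R) : Prop :=
  (forall x, A x -> derivable f x ((1, 0) : R * R) /\
                    derivable f x ((0, 1) : R * R)) /\
  {in A, continuous (partial1 f)} /\ {in A, continuous (partial2 f)}.

Definition bd (A : set (R * R)) : set (R * R) := closure A `\` A°.

(* The boundary of A is of class C^1, A lies locally on one side of it, and n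
   is the outward unit normal: locally A = {psi < 0} with grad psi <> 0. *)
Definition outward_normal (A : set (R * R)) (n : R * R -> 'cV[R]_3) : Prop :=
  forall y, bd A y -> exists (U : set (R * R)) (psi : R * R -> R),
    [/\ open U, U y, C1_on U psi,
        forall x, U x -> grad_x psi x != 0 &
        (forall x, U x -> (A x <-> psi x < 0)) /\
        (forall x, U x -> bd A x ->
           n x = (enorm (grad_x psi x))^-1 *: grad_x psi x)].

End VectorCalculus.

Notation lambda2 R := (product_measure1 (@lebesgue_measure R) (@lebesgue_measure R)).
Notation lambda3 R := (product_measure1 (lambda2 R) (@lebesgue_measure R)).

Record data (R : realType) := Data {
  Omega_x : set (R * R);
  normal : R * R -> 'cV[R]_3;
  h_bot : R * R -> R;
  h_soil : R * R -> R;
  delta : R;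
  rho : R;
  grav : R;
  P_s : R;
  sat : R -> R;
  k_r : R -> R;
  phi : R * R -> R -> R;
  K_0 : R * R -> R -> 'M[R]_3;
  alpha : R;
  beta : R;
  (* the source F at the point (x, h_soil x) of the soil surface *)
  F_soil : R -> R * R -> R;
  P_init : R * R -> R -> R;
  H_init : R * R -> R;
  T_end : R }.

(* Ht_ stands for \tilde H. *)
Record unknowns (R : realType) := Unknowns {
  P_ : R -> R * R -> R -> R;
  v_ : R -> R * R -> R -> 'cV[R]_3;
  u_ : R -> R * R -> R -> 'cV[R]_3;
  w_ : R -> R * R -> R -> 'cV[R]_3;
  Ht_ : R -> R * R -> R;
  h_ : R -> R * R -> R }.

Section Model.
Context {R : realType} (D : data R) (sol : unknowns R).

Definition h_max (x : R * R) : R := h_soil D x - delta D.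

Definition Omega : set ((R * R) * R) :=
  [set p | Omega_x D p.1 /\ h_bot D p.1 < p.2 < h_soil D p.1].

Definition Omega_minus (t : R) : set ((R * R) * R) :=
  [set p | Omega p /\ p.2 < h_ sol t p.1].

Definition Omega_plus (t : R) : set ((R * R) * R) :=
  [set p | Omega p /\ h_ sol t p.1 < p.2].

Definition K_zz (x : R * R) (z : R) : R := K_0 D x z ord_max ord_max.

Definition S_0 (x : R * R) (z : R) : 'M[R]_2 :=
  let K : 'M[R]_(2 + 1) := K_0 D x z in
  ulsubmx K - (K_zz x z)^-1 *: (ursubmx K *m dlsubmx K).

Definition M_0 (x : R * R) (z : R) : 'M[R]_3 :=
  (block_mx (S_0 x z) 0 0 0 : 'M[R]_(2 + 1)).

Definition Ktilde_integrand (t : R) (x : R * R) (i j : 'I_3) (z : R) : R :=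
  k_r D (rho D * grav D * (Ht_ sol t x - z)) * M_0 x z i j.

Definition Ktilde (t : R) (x : R * R) : 'M[R]_3 :=
  \matrix_(i < 3, j < 3)
    (\int[lebesgue_measure]_(z in `]h_bot D x, h_soil D x[)
       Ktilde_integrand t x i j z).

Definition flux (t : R) (x : R * R) : 'cV[R]_3 :=
  Ktilde t x *m grad_x (Ht_ sol t) x.

Definition uz (t : R) (x : R * R) (z : R) : R := dot (u_ sol t x z) e3.

(* Traces of u . e_3 on Gamma_h from above, and on Gamma_soil from below. *)
Definition uz_above (t : R) (x : R * R) : R := lim (uz t x @ (h_ sol t x)^'+).
Definition uz_soil (t : R) (x : R * R) : R := lim (uz t x @ (h_soil D x)^'-).

Definition dt_sat (t : R) (x : R * R) (z : R) : R :=
  derive1 (fun tau => sat D (P_ sol tau x z)) t.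

Definition data_ok : Prop :=
  [/\ [/\ open (Omega_x D), connected (Omega_x D),
          outward_normal (Omega_x D) (normal D),
          forall x, Omega_x D x -> h_bot D x < h_soil D x & 0 < delta D],
      [/\ 0 < rho D, 0 < grav D, 0 < T_end D,
          forall p, sat D p = 1 <-> P_s D <= p &
          forall p, k_r D p = 1 <-> P_s D <= p],
      (forall x z, Omega (x, z) -> 0 < phi D x z < 1),
      (forall x z, Omega (x, z) -> (K_0 D x z)^T = K_0 D x z /\
         forall xi : 'cV[R]_3, xi != 0 -> 0 < dot xi (K_0 D x z *m xi)) &
      [/\ 0 <= alpha D, 0 <= beta D & (alpha D, beta D) != (0, 0)]].

Definition eq1 : Prop :=
  [/\ forall t x z, 0 < t < T_end D -> Omega_plus t (x, z) ->
        phi D x z * dt_sat t x z + derive1 (uz t x) z = 0,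
      forall t x, 0 < t < T_end D -> Omega_x D x ->
        alpha D * P_ sol t x (h_soil D x) + beta D * uz_soil t x = F_soil D t x,
      forall t x, 0 < t < T_end D -> Omega_x D x ->
        P_ sol t x (h_ sol t x) = rho D * grav D * (Ht_ sol t x - h_ sol t x) &
      forall x z, Omega_plus 0 (x, z) -> P_ sol 0 x z = P_init D x z].

Definition eq2 : Prop :=
  forall t x z, 0 <= t < T_end D -> Omega_minus t (x, z) ->
    P_ sol t x z = rho D * grav D * (Ht_ sol t x - z).

Definition eq3 : Prop :=
  [/\ forall t x, 0 < t < T_end D -> Omega_x D x ->
        div_x (flux t) x = uz_above t x,
      forall t y, 0 < t < T_end D -> bd (Omega_x D) y ->
        dot (flux t x) (normal D y)
          @[x --> within (Omega_x D) (nbhs y)] --> (0 : R) &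
      forall x, Omega_x D x -> Ht_ sol 0 x = H_init D x].

Definition eq4 : Prop :=
  forall t x, 0 <= t < T_end D -> Omega_x D x ->
    h_bot D x <= h_ sol t x <=
      Num.max (Num.min (Ht_ sol t x - P_s D / (rho D * grav D)) (h_max x))
              (h_bot D x).

(* On Gamma_h itself P has in general no z-derivative: there the formula for u
   has no classical meaning and is not imposed. *)
Definition eq5 : Prop :=
  forall t x z, 0 < t < T_end D -> Omega (x, z) ->
  [/\ v_ sol t x z = u_ sol t x z + w_ sol t x z,
      z != h_ sol t x ->
        u_ sol t x z = - k_r D (P_ sol t x z) *:
          ((rho D * grav D)^-1 * derive1 (P_ sol t x) z + 1) *: (K_0 D x z *m e3) &
      w_ sol t x z = - k_r D (rho D * grav D * (Ht_ sol t x - z)) *: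
          (M_0 x z *m grad_x (Ht_ sol t) x)].

Definition solution : Prop := [/\ eq1, eq2, eq3, eq4 & eq5].

Definition regular_data : Prop :=
  [/\ {within Omega_x D, continuous (h_bot D)},
      {within Omega_x D, continuous (h_soil D)} &
      measurable_fun (Omega : set ((measurableTypeR R * measurableTypeR R)
                                   * measurableTypeR R))
        (fun p => phi D p.1 p.2)].

(* P and s(P) are continuous, also across Gamma_h; P is continuous up to the
   lower and upper boundaries, where it is evaluated in eq1. *)
Definition regular_P : Prop :=
  [/\ {within [set q : R * ((R * R) * R) | 0 <= q.1 < T_end D /\
         Omega_x D q.2.1 /\ h_bot D q.2.1 <= q.2.2 <= h_soil D q.2.1],
       continuous (fun q => P_ sol q.1 q.2.1 q.2.2)},
      {within [set q : R * ((R * R) * R) | 0 < q.1 < T_end D /\ Omega q.2],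
       continuous (fun q => sat D (P_ sol q.1 q.2.1 q.2.2))},
      (forall t x z, 0 < t < T_end D -> Omega_plus t (x, z) ->
         derivable (P_ sol t x) z 1 /\
         derivable (fun tau => sat D (P_ sol tau x z)) t 1) &
      (* phi d_t s(P) is dominated, locally uniformly in time *)
      forall t0, 0 < t0 < T_end D ->
        exists (eps : R) (G : (R * R) * R -> R),
          [/\ 0 < eps, (lambda3 R).-integrable Omega (EFin \o G) &
              forall t x z, `|t - t0| < eps -> 0 < t < T_end D ->
                Omega_plus t (x, z) ->
                `|phi D x z * dt_sat t x z| <= G (x, z)]].

Definition finite_mass : Prop :=
  forall t, 0 < t < T_end D ->
    (lambda3 R).-integrable (Omega_plus t)
      (fun p => (phi D p.1 p.2 * sat D (P_ sol t p.1 p.2))%:E) /\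
    (lambda3 R).-integrable (Omega_minus t) (fun p => (phi D p.1 p.2)%:E).

(* u . e_3 is C^1 in z above Gamma_h and has traces at both ends. *)
Definition regular_u : Prop :=
  forall t x, 0 < t < T_end D -> Omega_x D x ->
  [/\ forall z, h_ sol t x < z < h_soil D x -> derivable (uz t x) z 1,
      {in `]h_ sol t x, h_soil D x[, continuous (derive1 (uz t x))},
      cvg (uz t x @ (h_ sol t x)^'+) &
      cvg (uz t x @ (h_soil D x)^'-)].

(* The flux is C^1 in Omega_x and continuous up to the boundary. The last two
   conditions say something only if Omega_x is unbounded or if the divergence
   is not bounded up to the boundary. *)
Definition regular_flux : Prop :=
  forall t, 0 < t < T_end D ->
  [/\ C1_on (Omega_x D) (Ht_ sol t),
      forall x i j, Omega_x D x -> (@lebesgue_measure R).-integrable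
        `]h_bot D x, h_soil D x[ (EFin \o Ktilde_integrand t x i j),
      forall i, C1_on (Omega_x D) (fun x => flux t x i 0) /\
        forall y, bd (Omega_x D) y ->
          cvg (flux t x i 0 @[x --> within (Omega_x D) (nbhs y)]),
      forall i, (lambda2 R).-integrable (Omega_x D)
        (fun x => (flux t x i 0)%:E) &
      (lambda2 R).-integrable (Omega_x D) (EFin \o div_x (flux t))].

Definition regular_Ht_h : Prop :=
  {within [set q : R * (R * R) | 0 <= q.1 < T_end D /\ Omega_x D q.2],
   continuous (fun q => Ht_ sol q.1 q.2)} /\
  {within [set q : R * (R * R) | 0 <= q.1 < T_end D /\ Omega_x D q.2],
   continuous (fun q => h_ sol q.1 q.2)}.

Definition sufficiently_regular : Prop :=
  [/\ regular_data, regular_P /\ finite_mass, regular_u, regular_flux &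
      regular_Ht_h].

Definition M_tot (t : R) : R :=
  rho D * (\int[lambda2 R]_(x in Omega_x D)
     (\int[lebesgue_measure]_(z in `]h_ sol t x, h_soil D x[)
        (phi D x z * sat D (P_ sol t x z))))
  + rho D * (\int[lambda2 R]_(x in Omega_x D)
     (\int[lebesgue_measure]_(z in `]h_bot D x, h_ sol t x[) phi D x z)).

End Model.

(* Main.v *)
Require Import Defs.
From HB Require Import structures.
From mathcomp Require Import all_boot all_order all_algebra.
From mathcomp Require Import all_classical all_reals all_analysis.
From mathcomp Require Import measurable_realfun lra ring.
Import Order.TTheory GRing.Theory Num.Theory.
Import numFieldNormedType.Exports.
Local Open Scope classical_set_scope.
Local Open Scope ring_scope.
Set Implicit Arguments.
Unset Strict Implicit.
Unset Printing Implicit Defensive.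

(** Up to the water table z = h the pressure is hydrostatic, and the bound on h
    forces it above P_s there, so that s(P) = 1 for z <= h. Hence M_tot(t) is rho
    times the integral over the fixed domain Omega of the single function
    phi * s(P), and the moving interface disappears from the formula.

    Fix (x, z). In time, s(P) is continuous, equal to 1 on the closed set of
    times at which h >= z, and differentiable at the other times, where
    |phi * d_t s(P)| is bounded by the dominating function G. Such a function is
    Lipschitz with constant |G| / phi ([lipschitz_off_contact]), whatever the
    number of passages of the interface through z. Off the graph of h(t), which
    is negligible, it is moreover differentiable at time t. Dominated
    convergence then differentiates under the integral ([is_derive_Rintegral]):
    the derivative of M_tot is rho times the integral of phi * d_t s(P) over the
    part of Omega above h.

    There phi * d_t s(P) = - d_z (u . e_3), and integration along the vertical
    lines turns this integral into the integral over Omega_x of the trace of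
    u . e_3 above h minus its trace at the soil ([Rintegral_column_flux]).

    The trace above h is the horizontal divergence of the flux, whose integral
    over Omega_x has to vanish. This is a divergence theorem on a possibly
    unbounded domain with C^1 boundary, for a field with vanishing normal
    component ([Rintegral_divergence_tangent0]). The boundary is not flattened.
    Write the domain locally as {psi < 0} and multiply the field by a test function
    with small support and by an inner cutoff, a function of psi / eps that
    vanishes near {psi = 0}. The product has
    compact support in the domain, so that the integral of its divergence
    vanishes by Fubini and the fundamental theorem of calculus
    ([Rintegral_inner_cutoff]). As eps tends to 0 the cutoff contributes
    F . grad psi / eps integrated over a strip of area O(eps) ([strip_area]), and
    this tends to 0 because F . grad psi tends to 0 at the boundary
    ([weak_div_local]). A partition of unity glues these local identities
    ([weak_div_compact]), and cutoffs growing to the whole plane conclude, since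
    the field and its divergence are integrable. *)

(** * Open sets of the plane and of space are measurable *)

Section CountableBase.

(** The neighborhood system [N] is a parameter, instead of being that of a
    topology on [T], because the types that carry the product sigma-algebra and
    the product topology are only convertible. *)
Definition countably_based d (T : measurableType d) (N : T -> set_system T) :=
  exists (I : countType) (B : I -> set T),
    (forall i, measurable (B i)) /\
    forall x U, N x U -> exists2 i, B i x & B i `<=` U.

Lemma countably_based_measurable d (T : measurableType d)
    (N : T -> set_system T) (U : set T) :
  countably_based N -> (forall x, U x -> N x U) -> measurable U.
Proof.
move=> [I [B [mB NB]]] NU.
have -> : U = \bigcup_(i in [set i | B i `<=` U]) B i.
  apply/seteqP; split=> [x Ux|x [i BU /BU//]].
  by have [i Bx BU] := NB _ _ (NU _ Ux); exists i.
rewrite bigcup_mkcond; apply: countable_bigcupT_measurable => [|i].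
  exact: countableP.
by case: ifPn => // _; exact: measurable0.
Qed.

Lemma countably_based_prod d1 d2 (T1 : measurableType d1)
    (T2 : measurableType d2) (N1 : T1 -> set_system T1)
    (N2 : T2 -> set_system T2) :
  countably_based N1 -> countably_based N2 ->
  countably_based (T := (T1 * T2)%type)
    (fun x => filter_prod (N1 x.1) (N2 x.2)).
Proof.
move=> [I1 [B1 [mB1 NB1]]] [I2 [B2 [mB2 NB2]]].
exists (I1 * I2)%type, (fun i => B1 i.1 `*` B2 i.2); split.
  by move=> i; exact: measurableX.
move=> [x1 x2] U [[U1 U2] /= [NU1 NU2] sub].
have [i1 Bx1 BU1] := NB1 _ _ NU1; have [i2 Bx2 BU2] := NB2 _ _ NU2.
exists (i1, i2) => //= -[y1 y2] [/= By1 By2]; apply: sub.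
by split; [exact: BU1|exact: BU2].
Qed.

End CountableBase.

Section PlaneMeasurability.
Context {R : realType}.
Local Notation Rm := (measurableTypeR R).
Local Notation plane := (Rm * Rm)%type.
Local Notation space := (plane * Rm)%type.

Lemma countably_based_line : countably_based (T := Rm) (fun x : R => nbhs x).
Proof.
exists (rat * rat)%type, (fun q => `]ratr q.1, ratr q.2[%classic); split.
  by move=> i; exact: measurable_itv.
move=> x U /nbhs_ballP[e /= e0 xeU].
have xe : x - e < x by rewrite ltrBlDr ltrDl.
have ex : x < x + e by rewrite ltrDl.
have [p] := rat_in_itvoo xe.
rewrite in_itv/= => /andP[p1 p2].
have [q] := rat_in_itvoo ex.
rewrite in_itv/= => /andP[q1 q2].
exists (p, q) => /=; first by rewrite in_itv/= p2 q1.
move=> y /=; rewrite in_itv/= => /andP[py yq]; apply: xeU.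
by rewrite /ball/= ltr_distlC (lt_trans p1 py) (lt_trans yq q2).
Qed.

(** The sigma-algebra of the plane is generated by rectangles; an open set is a
    countable union of rational ones. *)
Lemma open_plane_measurable (U : set (R * R)) :
  open U -> measurable (U : set plane).
Proof.
move=> oU; apply: countably_based_measurable.
  exact: countably_based_prod countably_based_line countably_based_line.
by move=> x Ux; exact: (@open_nbhs_nbhs (R * R)%type x U (conj oU Ux)).
Qed.

Lemma open_space_measurable (U : set ((R * R) * R)) :
  open U -> measurable (U : set space).
Proof.
move=> oU; apply: countably_based_measurable.
  apply: countably_based_prod countably_based_line.
  exact: countably_based_prod countably_based_line countably_based_line.
by move=> x Ux; exact: (@open_nbhs_nbhs (R * R * R)%type x U (conj oU Ux)).
Qed.

Lemma continuous_plane_measurable (A : set (R * R)) (f : R * R -> R) :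
  open A -> {in A, continuous f} -> measurable_fun (A : set plane) f.
Proof.
move=> oA cf; apply: (measurability _ (RGenOpens.measurableE R)).
move=> _ [_ [a [b ->] <-]]; apply: open_plane_measurable.
rewrite openE => x [Ax fx]; apply: filterI; first exact: open_nbhs_nbhs.
by apply: cf; [exact: mem_set|exact: open_nbhs_nbhs (conj (interval_open _ _) fx)].
Qed.

End PlaneMeasurability.

(** * Integrals of real functions, and Fubini for bands *)

Section RealIntegrals.
Context d (T : measurableType d) (R : realType) (mu : {measure set T -> \bar R}).

Section RealIntegrands.
Variables (D : set T) (mD : measurable D).
Implicit Types f g h : T -> R.

Lemma integrable_EFinN f : mu.-integrable D (EFin \o f) ->
  mu.-integrable D (EFin \o (fun x => - f x)).
Proof. exact: integrableN. Qed.

Lemma integrable_EFinD f g : mu.-integrable D (EFin \o f) ->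
  mu.-integrable D (EFin \o g) -> mu.-integrable D (EFin \o (fun x => f x + g x)).
Proof. exact: integrableD. Qed.

Lemma integrable_EFin_bounded_mul h f (M : R) : measurable_fun D h ->
  (forall x, D x -> `|h x| <= M) -> mu.-integrable D (EFin \o f) ->
  mu.-integrable D (EFin \o (fun x => h x * f x)).
Proof.
move=> mh hM intf; have /measurable_EFinP mf := measurable_int mu intf.
apply: (@le_integrable _ _ _ mu D mD _ (fun x => M%:E * (EFin \o f) x)%E).
- by apply/measurable_EFinP; exact: measurable_funM.
- move=> x Dx; rewrite /= lee_fin !normrM ler_wpM2r//.
  by rewrite (le_trans (hM _ Dx))// ler_norm.
- exact: integrableZl.
Qed.

End RealIntegrands.

Lemma Rintegral_dominated_convergence (D : set T) (f_ : nat -> T -> R)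
    (f : T -> R) (g : T -> \bar R) :
  measurable D -> (forall n, measurable_fun D (f_ n)) ->
  (forall x, D x -> f_ ^~ x @ \oo --> f x) ->
  mu.-integrable D g -> (forall n x, D x -> (`|(f_ n x)%:E| <= g x)%E) ->
  mu.-integrable D (EFin \o f) /\
  (\int[mu]_(x in D) f_ n x) @[n --> \oo] --> \int[mu]_(x in D) f x.
Proof.
move=> mD mf f_f ig fg.
have mf_ n : measurable_fun D (EFin \o f_ n) by exact/measurable_EFinP.
have cf x : D x -> (fun n => (f_ n x)%:E) @ \oo --> (f x)%:E.
  by move=> Dx; apply: cvg_EFin; [exact: nearW|exact: f_f].
have mfl : measurable_fun D (EFin \o f) by exact: emeasurable_fun_cvg mf_ cf.
have [intf _ cvgf] := @dominated_convergence _ _ _ mu D mD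
  (fun n => EFin \o f_ n) (EFin \o f) g mf_ mfl (aeW _ cf) ig
  (aeW _ (fun x n Dx => fg n x Dx)).
split=> //.
have : (fine (\int[mu]_(x in D) (f_ n x)%:E)) @[n --> \oo] -->
    fine (\int[mu]_(x in D) (f x)%:E).
  apply: fine_cvg; rewrite fineK//; exact: integrable_fin_num.
exact.
Qed.

End RealIntegrals.

Section PlaneArea.
Context {R : realType}.
Local Notation Rm := (measurableTypeR R).

(** A copy of [lambda2 R] on which the structure of sigma-finite measure is
    declared: the theorems of Fubini ask for it when the plane is itself a factor
    of a product. *)
Definition area : set (Rm * Rm) -> \bar R := lambda2 R.

HB.instance Definition _ := Measure.on area.

Let area_sigma_finite : sigma_finite setT area.
Proof.
exists (fun n : nat => `[- n%:R, n%:R]%classic `*` `[- n%:R, n%:R]%classic).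
  apply/esym; rewrite -subTset => -[x y] _.
  exists (Num.truncn (`|x| + `|y|)).+1 => //; split; rewrite /= in_itv/= -ler_norml.
    by rewrite ltW// (le_lt_trans _ (truncnS_gt _))// lerDl.
  by rewrite ltW// (le_lt_trans _ (truncnS_gt _))// lerDr.
move=> n; split; first by apply: measurableX; exact: measurable_itv.
rewrite /area product_measure1E//; try exact: measurable_itv.
have side : ((@lebesgue_measure R) `[(- n%:R)%R, n%:R%R]%classic < +oo)%E.
  by rewrite lebesgue_measure_itv/=; case: ifP => _; rewrite ltry.
by rewrite lte_mul_pinfty// ge0_fin_numE.
Qed.

HB.instance Definition _ := Measure_isSigmaFinite.Build _ _ _ area
  area_sigma_finite.

End PlaneArea.

Section Bands.
Context {R : realType}.
Local Notation Rm := (measurableTypeR R).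
Local Notation plane := (Rm * Rm)%type.
Local Notation space := (plane * Rm)%type.

(** Omega and its parts above and below the water table have this shape. *)
Definition band (A : set (R * R)) (a b : R * R -> R) : set ((R * R) * R) :=
  [set p | A p.1 /\ a p.1 < p.2 < b p.1].

Lemma open_band (A : set (R * R)) (a b : R * R -> R) :
  open A -> {in A, continuous a} -> {in A, continuous b} -> open (band A a b).
Proof.
move=> oA ca cb; rewrite openE => -[x z] [/= Ax /andP[az zb]].
have nA : \forall p \near (x, z), A p.1.
  by apply: (@cvg_fst _ _ (nbhs x) (nbhs z)); exact: open_nbhs_nbhs.
have ctop (c : R * R -> R) : {in A, continuous c} ->
    (fun p : (R * R) * R => p.2 - c p.1) @ (x, z) --> z - c x.
  move=> cc; apply: cvgB; first exact: cvg_snd.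
  apply: (cvg_comp _ _ (@cvg_fst _ _ (nbhs x) (nbhs z) _)); apply: cc.
  exact: mem_set.
have na : \forall p \near (x, z), 0 < p.2 - a p.1.
  by apply: (cvgr_gt _ (ctop _ ca)); rewrite subr_gt0.
have nb : \forall p \near (x, z), p.2 - b p.1 < 0.
  by apply: (cvgr_lt _ (ctop _ cb)); rewrite subr_lt0.
near=> p; split; first by near: p.
apply/andP; split; first by rewrite -subr_gt0; near: p.
by rewrite -subr_lt0; near: p.
Unshelve. all: by end_near. Qed.

Lemma band_measurable (A : set (R * R)) (a b : R * R -> R) :
  open A -> {in A, continuous a} -> {in A, continuous b} ->
  measurable (band A a b : set space).
Proof. by move=> oA ca cb; apply: open_space_measurable; exact: open_band. Qed.

Section FubiniBand.
Variables (A : set (R * R)) (a b : R * R -> R) (f : R * R -> R -> R).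
Hypothesis oA : open A.
Hypothesis ca : {in A, continuous a}.
Hypothesis cb : {in A, continuous b}.
Hypothesis intf :
  (lambda3 R).-integrable (band A a b) (fun p => (f p.1 p.2)%:E).

Let I (x : R * R) : \bar R :=
  (\int[@lebesgue_measure R]_(z in `]a x, b x[) (f x z)%:E)%E.

Let fubini_bandE :
  fubini_F (@lebesgue_measure R) ((fun p : space => (f p.1 p.2)%:E) \_ (band A a b))
  = I \_ A.
Proof.
apply/funext => x; rewrite /fubini_F patchE /I.
case: ifPn => [/set_mem Ax|/negP Ax].
  rewrite [RHS]integral_mkcond; apply: eq_integral => z _ /=.
  rewrite !patchE /=; congr (if _ then _ else _).
  apply/idP/idP => /set_mem; first by move=> [_ /= h]; apply/mem_set; rewrite /= in_itv.
  by rewrite /= in_itv => h; apply/mem_set; split.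
apply: integral0_eq => z _; rewrite patchE ifF//.
by apply/negP => /set_mem[/= Ax' _]; apply: Ax; exact/mem_set.
Qed.

Lemma integrable_fubini_band : (lambda2 R).-integrable A I.
Proof.
have mb := band_measurable oA ca cb.
apply/(integrable_mkcond _ (open_plane_measurable oA)).
rewrite -fubini_bandE.
apply: (@integrable_fubini_F _ _ plane Rm R area (@lebesgue_measure R)).
by move/(integrable_mkcond _ mb) : intf.
Qed.

Lemma integral_fubini_band :
  (\int[lambda2 R]_(x in A) I x = \int[lambda3 R]_(p in band A a b) (f p.1 p.2)%:E)%E.
Proof.
have mb := band_measurable oA ca cb.
rewrite integral_mkcond -fubini_bandE.
rewrite (@integral12_prod_meas1 _ _ plane Rm R area (@lebesgue_measure R)).
  by rewrite [RHS]integral_mkcond.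
by move/(integrable_mkcond _ mb) : intf.
Qed.

Lemma measurable_fubini_band :
  measurable_fun (A : set plane)
    (fun x => \int[@lebesgue_measure R]_(z in `]a x, b x[) f x z).
Proof.
apply: (measurableT_comp (f := fine)) => //.
exact: (measurable_int _ integrable_fubini_band).
Qed.

(** The inner integrals are finite for almost every x only, whence the passage
    through extended reals. *)
Lemma Rintegral_fubini_band :
  \int[lambda2 R]_(x in A) (\int[@lebesgue_measure R]_(z in `]a x, b x[) f x z)
  = \int[lambda3 R]_(p in band A a b) f p.1 p.2.
Proof.
rewrite /Rintegral -integral_fubini_band; congr fine.
have mA := open_plane_measurable oA.
apply: ae_eq_integral => //.
- apply/measurable_EFinP. exact: measurable_fubini_band.
- exact: (measurable_int _ integrable_fubini_band).
have := integrable_ae mA integrable_fubini_band.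
by apply: filterS => x /[apply]; exact: fineK.
Qed.

End FubiniBand.

End Bands.

(** * Differentiation in time across a moving contact set *)

Section Derivatives.
Context {R : realType}.
Implicit Types f : R -> R.

Lemma is_derive_quotient f (t df : R) :
  is_derive t 1 f df <-> h^-1 * (f (h + t) - f t) @[h --> 0^'] --> df.
Proof.
have E : (fun h : R => h^-1 * (f (h + t) - f t)) =
    (fun h => h^-1 *: ((f \o shift t) (h *: (1 : R)) - f t)).
  by apply/funext => h; rewrite /= [h *: 1]mulr1.
rewrite E; split=> [[dft <-]|cf]; first exact: dft.
by apply: DeriveDef; [exact: cvgP cf|exact/cvg_lim].
Qed.

Lemma mean_value_le f (a b M : R) : a <= b ->
  {in `[a, b], continuous f} ->
  (forall x, a < x < b -> derivable f x 1 /\ `|derive1 f x| <= M) ->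
  `|f b - f a| <= M * (b - a).
Proof.
move=> ab cf df.
have [->|neq_ab] := eqVneq a b; first by rewrite !subrr normr0 mulr0.
have {neq_ab}ab : a < b by rewrite lt_neqAle neq_ab ab.
have [x| |c cab ->] := @MVT R f (derive1 f) a b ab.
- rewrite in_itv/= => /df[dfx _].
  by rewrite derive1E; exact/derivableP.
- by apply: continuous_in_subspaceT => x /set_mem; exact: cf.
rewrite normrM [`|b - a|]ger0_norm ?subr_ge0 ?(ltW ab)//.
rewrite ler_wpM2r ?subr_ge0 ?(ltW ab)//.
by move: cab; rewrite in_itv/= => /df[].
Qed.

Lemma last_contact (h : R -> R) (a b z x : R) :
  {in `[a, b], continuous h} -> a <= x <= b -> z <= h x ->
  exists c, [/\ a <= c <= b, z <= h c & forall y, a <= y <= b -> z <= h y -> y <= c].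
Proof.
move=> ch xab zx; pose C := [set y | a <= y <= b /\ z <= h y].
have supC : has_sup C by split; [exists x|exists b => y [/andP[]]].
have leC y : C y -> y <= sup C by exact: ub_le_sup supC.2 _.
have abC : a <= sup C <= b.
  have /andP[ax xb] := xab; rewrite (le_trans ax (leC _ (conj xab zx)))/=.
  by apply: ge_sup => [|y [/andP[]]]; first exact: supC.1.
exists (sup C); split=> //; last by move=> y yab zy; exact: leC.
rewrite leNgt; apply/negP => hz.
have hcont : h @ sup C --> h (sup C) by apply: ch; rewrite in_itv/=.
have : \forall y \near sup C, h y < z by exact: (cvgr_lt _ hcont).
move=> /nbhs_ballP[e /= e0 eh].
have [y [yab zy] yC] := sup_adherent e0 supC.
have : h y < z.
  apply: eh; rewrite /ball/= ger0_norm ?subr_ge0 ?leC//.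
  by rewrite ltrBlDr -ltrBlDl.
by rewrite ltNge zy.
Qed.

(** If the contact set {z <= h} meets [a, b], then f equals c at its first and
    last points; the mean value theorem applies before the first and after
    the last. In between f may fail to be differentiable at infinitely many
    points, but only the values at these two points enter. *)
Lemma lipschitz_off_contact f (h : R -> R) (a b c z M : R) :
  a <= b -> 0 <= M ->
  {in `[a, b], continuous f} -> {in `[a, b], continuous h} ->
  (forall x, a <= x <= b -> z <= h x -> f x = c) ->
  (forall x, a <= x <= b -> h x < z -> derivable f x 1 /\ `|derive1 f x| <= M) ->
  `|f b - f a| <= M * (b - a).
Proof.
move=> ab M0 cf ch fc df.
(* The distance to the value c, to the right of a point of contact; the left
   side follows by reflection. *)
have contact_right : forall f' h' a' b', a' <= b' ->
    {in `[a', b'], continuous f'} -> {in `[a', b'], continuous h'} ->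
    (forall x, a' <= x <= b' -> z <= h' x -> f' x = c) ->
    (forall x, a' <= x <= b' -> h' x < z ->
      derivable f' x 1 /\ `|derive1 f' x| <= M) ->
    forall x, a' <= x <= b' -> z <= h' x -> `|f' b' - c| <= M * (b' - x).
  move=> {f h a b ab cf ch fc df} f h a b ab cf ch fc df x xab zx.
  have [y [/andP[ay yb] zy ly]] := last_contact ch xab zx.
  rewrite -(fc y) ?ay//.
  have sub w : w \in `[y, b] -> w \in `[a, b].
    by rewrite !in_itv/= => /andP[yw ->]; rewrite (le_trans ay).
  have : `|f b - f y| <= M * (b - y).
    apply: mean_value_le => //; first by move=> w /sub; exact: cf.
    move=> w /andP[yw wb].
    have awb : a <= w <= b by rewrite (ltW wb) (le_trans ay (ltW yw)).
    by apply: df => //; rewrite ltNge; apply/negP => /(ly w awb); rewrite leNgt yw.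
  by move/le_trans; apply; rewrite ler_wpM2l// lerB// ly.
have [[x [xab zx]]|nC] := pselect (exists x, a <= x <= b /\ z <= h x); last first.
  apply: mean_value_le => // x /andP[ax xb].
  have xab : a <= x <= b by rewrite !ltW.
  by apply: df => //; rewrite ltNge; apply/negP => zx; apply: nC; exists x.
have right := contact_right f h a b ab cf ch fc df x xab zx.
have mem_opp (y : R) : y \in `[- b, - a] -> - y \in `[a, b].
  by rewrite !in_itv/= lerNr lerNl andbC.
have left : `|f a - c| <= M * (x - a).
  have -> : f a = (f \o -%R) (- a) by rewrite /= opprK.
  have -> : x - a = - a - (- x) by rewrite opprK addrC.
  apply: (contact_right (f \o -%R) (h \o -%R) (- b) (- a)) => //=.
  - by rewrite lerN2.
  - by move=> y /mem_opp yab; apply: continuous_comp; [exact: opp_continuous|exact: cf].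
  - by move=> y /mem_opp yab; apply: continuous_comp; [exact: opp_continuous|exact: ch].
  - by move=> y yab; apply: fc; exact: mem_opp.
  - move=> y yab hyz.
    have [dfy Mfy] := df _ (mem_opp _ yab) hyz.
    have dfy' : is_derive (- y) 1 f (derive1 f (- y)).
      by rewrite derive1E; exact/derivableP.
    have dcomp : is_derive y 1 (f \o -%R) (- derive1 f (- y)).
      have := @is_derive1_comp R f -%R y _ _ dfy' (is_deriveNid y 1).
      by rewrite mulrN1.
    split; first by case: dcomp.
    by rewrite derive1E (@derive_val _ _ _ _ _ _ _ dcomp) normrN.
  - by rewrite !lerN2 andbC.
  - by rewrite opprK.
have -> : f b - f a = (f b - c) - (f a - c) by rewrite opprB addrA subrK.
rewrite (le_trans (ler_normB _ _))// (le_trans (lerD right left))// -mulrDr.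
by rewrite ler_wpM2l// addrA subrK.
Qed.

End Derivatives.

Section LeibnizRule.
Context d (T : measurableType d) (R : realType) (mu : {measure set T -> \bar R}).

(** A Lipschitz bound at the single time [t], rather than a bound on the
    derivative at neighboring times: the integrand of the mass need not be
    differentiable when the interface passes. *)
Lemma is_derive_Rintegral (D : set T) (F : R -> T -> R) (F' G : T -> R)
    (t eps : R) :
  measurable D -> 0 < eps ->
  (forall s, `|s - t| < eps -> mu.-integrable D (EFin \o F s)) ->
  mu.-integrable D (EFin \o G) ->
  (forall s y, `|s - t| < eps -> D y -> `|F s y - F t y| <= G y * `|s - t|) ->
  (forall y, D y -> is_derive t 1 (F ^~ y) (F' y)) ->
  mu.-integrable D (EFin \o F') /\
  is_derive t 1 (fun s => \int[mu]_(y in D) F s y) (\int[mu]_(y in D) F' y).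
Proof.
move=> mD eps0 iF iG lipF dF.
have iFt : mu.-integrable D (EFin \o F t) by apply: iF; rewrite subrr normr0.
have seq_lim u : (forall n : nat, u n != 0) -> u n @[n --> \oo] --> (0 : R) ->
    (forall n, `|u n| < eps) ->
    mu.-integrable D (EFin \o F') /\
    (u n)^-1 * (\int[mu]_(y in D) F (u n + t) y - \int[mu]_(y in D) F t y)
      @[n --> \oo] --> \int[mu]_(y in D) F' y.
  move=> u0 cu ueps.
  have ut n : `|u n + t - t| < eps by rewrite addrK.
  have := @Rintegral_dominated_convergence _ _ _ mu D
    (fun n y => (u n)^-1 * (F (u n + t) y - F t y)) F' (EFin \o G) mD _ _ iG _.
  have -> // : (fun n => \int[mu]_(y in D) ((u n)^-1 * (F (u n + t) y - F t y))) =
      (fun n => (u n)^-1 * (\int[mu]_(y in D) F (u n + t) y - \int[mu]_(y in D) F t y)).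
    apply/funext => n; rewrite RintegralZl ?RintegralB//; first exact: iF.
    exact: (integrableB mD (iF _ (ut n)) iFt).
  apply.
  - move=> n; apply: measurable_funM => //; apply: measurable_funB.
      exact/measurable_EFinP/(measurable_int mu (iF _ (ut n))).
    exact/measurable_EFinP/(measurable_int mu iFt).
  - move=> y Dy; have /is_derive_quotient/cvgr_dnbhsP := dF y Dy.
    by apply; split.
  - move=> n y Dy; rewrite lee_fin normrM normfV ler_pdivrMl ?normr_gt0//.
    by rewrite mulrC; have := lipF _ _ (ut n) Dy; rewrite addrK.
split.
  (* Any one sequence of increments shows that the limit is integrable. *)
  pose u n := eps * 2^-1 * (n.+1%:R)^-1 : R.
  have u0 n : 0 < u n by rewrite /u !mulr_gt0.
  have [||//|//] := seq_lim u.
  - by move=> n; rewrite gt_eqF.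
  - rewrite -(mulr0 (eps * 2^-1)); apply: cvgM; first exact: cvg_cst.
    exact: cvg_harmonic.
  - move=> n; rewrite gtr0_norm// (@le_lt_trans _ _ (eps / 2))//.
      by rewrite /u ler_piMr ?divr_ge0 ?(ltW eps0)// invf_le1 ?ler1n.
    by rewrite gtr_pMr// invf_lt1 ?ltr1n.
apply/is_derive_quotient/cvgr_dnbhsP => u [u0 cu].
have [N _ Nu] : \forall n \near \oo, `|u n| < eps by exact: (cvgr0_norm_lt _ cu).
rewrite -(cvg_shiftn N) /=.
have [] := seq_lim (fun n => u (n + N)%N) => //.
- by rewrite (cvg_shiftn N u).
- by move=> n; apply: Nu => /=; exact: leq_addl.
Qed.

End LeibnizRule.

(** * Vertical balance in a band *)

Section VerticalFlux.
Context {R : realType}.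
Local Notation Rm := (measurableTypeR R).
Local Notation plane := (Rm * Rm)%type.
Local Notation space := (plane * Rm)%type.
Local Notation leb := (@lebesgue_measure R).

Lemma Rintegral_derive1 (g : R -> R) (c d : R) : c < d ->
  {in `[c, d], forall z, derivable g z 1} ->
  {in `[c, d], continuous (derive1 g)} ->
  leb.-integrable `]c, d[ (EFin \o derive1 g) /\
  \int[leb]_(z in `]c, d[) derive1 g z = g d - g c.
Proof.
move=> cd dg cg.
have sub z : z \in `]c, d[ -> z \in `[c, d] by apply: subset_itv_oo_cc.
have gcont z : z \in `[c, d] -> {for z, continuous g}.
  by move=> /dg/derivable1_diffP/differentiable_continuous.
have wcg : {within `[c, d], continuous (derive1 g)}.
  by apply: continuous_in_subspaceT => z /set_mem; exact: cg.
have intcc : leb.-integrable `[c, d] (EFin \o derive1 g).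
  by apply: continuous_compact_integrable => //; exact: segment_compact.
have intoo : leb.-integrable `]c, d[ (EFin \o derive1 g).
  exact: integrableS intcc.
split=> //.
have gLR : derivable_oo_LRcontinuous g c d.
  split.
  - by move=> z /sub; exact: dg.
  - by apply: cvg_at_right_filter; apply: gcont; rewrite in_itv/= lexx ltW.
  - by apply: cvg_at_left_filter; apply: gcont; rewrite in_itv/= lexx ltW.
have ftc := continuous_FTC2 cd wcg gLR (fun z _ => erefl).
rewrite /Rintegral -(@integral_itv_bndoo _ _ _ _ true false).
  by rewrite ftc.
exact: (measurable_int _ intoo).
Qed.

Section ColumnFlux.
Variables (A : set (R * R)) (a b : R * R -> R) (f g : R * R -> R -> R).
Variables (ga gb : R * R -> R).
Hypothesis oA : open A.
Hypothesis ca : {in A, continuous a}.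
Hypothesis cb : {in A, continuous b}.
Hypothesis ab : forall x, A x -> a x < b x.
Hypothesis intf :
  (lambda3 R).-integrable (band A a b) (fun p => (f p.1 p.2)%:E).
Hypothesis dg : forall x z, A x -> a x < z < b x ->
  derivable (g x) z 1 /\ f x z + derive1 (g x) z = 0.
Hypothesis cg : forall x, A x -> {in `]a x, b x[, continuous (derive1 (g x))}.
Hypothesis cvga : forall x, A x -> g x @ (a x)^'+ --> ga x.
Hypothesis cvgb : forall x, A x -> g x @ (b x)^'- --> gb x.

(* The bands between an and bn exhaust the band between a and b. Since w n < 1 / 2
   none of their fibers is empty. *)
Let w n : R := n.+3%:R^-1.

Let w_gt0 n : 0 < w n. Proof. by rewrite invr_gt0. Qed.

Let w_lt n : w n < 2^-1.
Proof. by rewrite ltf_pV2 ?posrE// ltr_nat. Qed.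

Let w0 : w n @[n --> \oo] --> (0 : R).
Proof.
have := @cvg_harmonic R; rewrite -(cvg_shiftn 2).
by under eq_fun do rewrite /= addn2.
Qed.

Let an n x := a x + (b x - a x) * w n.
Let bn n x := b x - (b x - a x) * w n.

Let an_gt n x : A x -> a x < an n x.
Proof. by move=> /ab abx; rewrite /an ltrDl mulr_gt0 ?subr_gt0. Qed.

Let bn_lt n x : A x -> bn n x < b x.
Proof. by move=> /ab abx; rewrite /bn ltrBlDr ltrDl mulr_gt0 ?subr_gt0. Qed.

Let an_bn n x : A x -> an n x < bn n x.
Proof.
move=> /ab abx; rewrite /an /bn -subr_gt0.
have -> : b x - (b x - a x) * w n - (a x + (b x - a x) * w n) =
  (b x - a x) * (1 - w n * 2) by ring.
by rewrite mulr_gt0 ?subr_gt0// -ltr_pdivlMr// div1r.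
Qed.

Let can n : {in A, continuous (an n)}.
Proof.
move=> x Ax; apply: cvgD; first exact: ca.
by apply: cvgM; [apply: cvgB; [exact: cb|exact: ca]|exact: cvg_cst].
Qed.

Let cbn n : {in A, continuous (bn n)}.
Proof.
move=> x Ax; apply: cvgB; first exact: cb.
by apply: cvgM; [apply: cvgB; [exact: cb|exact: ca]|exact: cvg_cst].
Qed.

Let an_cvg x : an n x @[n --> \oo] --> a x.
Proof.
rewrite -[X in _ --> X]addr0 -(mulr0 (b x - a x)).
by apply: cvgD; [exact: cvg_cst|apply: cvgM; [exact: cvg_cst|exact: w0]].
Qed.

Let bn_cvg x : bn n x @[n --> \oo] --> b x.
Proof.
rewrite -[X in _ --> X]subr0 -(mulr0 (b x - a x)).
by apply: cvgB; [exact: cvg_cst|apply: cvgM; [exact: cvg_cst|exact: w0]].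
Qed.

Let sub_n n : band A (an n) (bn n) `<=` band A a b.
Proof.
move=> [x z] [/= Ax /andP[az zb]]; split => //=.
by rewrite (lt_trans (an_gt n Ax) az) (lt_trans zb (bn_lt n Ax)).
Qed.

Let intfn n :
  (lambda3 R).-integrable (band A (an n) (bn n)) (fun p => (f p.1 p.2)%:E).
Proof.
have mab := band_measurable oA ca cb.
have mabn := band_measurable oA (@can n) (@cbn n).
exact: (integrableS mab mabn (@sub_n n) intf).
Qed.

Let J n x := \int[leb]_(z in `]an n x, bn n x[) f x z.

Let fE x z : A x -> a x < z < b x -> f x z = - derive1 (g x) z.
Proof. by move=> Ax abz; apply/eqP; rewrite -addr_eq0 (dg Ax abz).2. Qed.

Let JE n x : A x ->
  leb.-integrable `]an n x, bn n x[ (EFin \o f x) /\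
  J n x = g x (an n x) - g x (bn n x).
Proof.
move=> Ax.
have sub z : z \in `[an n x, bn n x] -> a x < z < b x.
  rewrite in_itv/= => /andP[az zb].
  by rewrite (lt_le_trans (an_gt n Ax) az) (le_lt_trans zb (bn_lt n Ax)).
have subo z : z \in `]an n x, bn n x[ -> a x < z < b x.
  by move=> zab; apply: sub; exact: subset_itv_oo_cc zab.
have [||ig Ig] := @Rintegral_derive1 (g x) _ _ (an_bn n Ax).
- by move=> z /sub abz; exact: (dg Ax abz).1.
- by move=> z /sub abz; apply: (cg Ax); rewrite in_itv.
split.
  have iN : leb.-integrable `]an n x, bn n x[ (EFin \o (fun z => - derive1 (g x) z)).
    exact: integrable_EFinN ig.
  apply: eq_integrable iN => // z /set_mem /subo abz /=.
  by rewrite fE.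
have -> : J n x = \int[leb]_(z in `]an n x, bn n x[) (-1 * derive1 (g x) z).
  by apply: eq_Rintegral => z /set_mem /subo abz; rewrite fE// mulN1r.
by rewrite RintegralZl// Ig mulN1r opprB.
Qed.

Let Iabs (x : R * R) : \bar R := (\int[leb]_(z in `]a x, b x[) `|f x z|%:E)%E.

(** On almost every vertical line f is integrable, but an equality almost
    everywhere would leave the measurability of the traces open. Exhaustion gives
    both: on the intervals ]an, bn[ the fundamental theorem of calculus holds for
    every x, it exhibits ga - gb as a pointwise limit of measurable functions, and
    the integral of |f| over the whole line dominates. *)
Lemma Rintegral_column_flux :
  (lambda2 R).-integrable A (EFin \o (fun x => gb x - ga x)) /\
  \int[lambda2 R]_(x in A) (gb x - ga x) =
    - \int[lambda3 R]_(p in band A a b) f p.1 p.2.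
Proof.
have mA : measurable (A : set plane) := open_plane_measurable oA.
have mab : measurable (band A a b : set space) by exact: band_measurable.
have mabn n : measurable (band A (an n) (bn n) : set space).
  exact: band_measurable.
have iIabs : (lambda2 R).-integrable A Iabs.
  apply: (@integrable_fubini_band R A a b (fun x z => `|f x z|)) => //.
  exact: (integrable_abse intf).
have cJx x : A x -> J n x @[n --> \oo] --> ga x - gb x.
  move=> Ax; under eq_fun do rewrite (JE _ Ax).2; apply: cvgB.
    have /cvg_at_rightP := cvga Ax; apply; split=> // n; exact: an_gt.
  have /cvg_at_leftP := cvgb Ax; apply; split=> // n; exact: bn_lt.
have leJ n x : A x -> (`|(J n x)%:E| <= Iabs x)%E.
  move=> Ax; have [iJ _] := JE n Ax.
  have mfx : measurable_fun `]a x, b x[ (f x).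
    apply: (eq_measurable_fun (fun z => - derive1 (g x) z)).
      by move=> z /set_mem; rewrite /= in_itv => abz; rewrite fE.
    apply: measurableT_comp => //; apply: open_continuous_measurable_fun => //.
    by move=> z /set_mem; exact: cg.
  rewrite -[(_)%:E]/(_ : \bar R) abse_EFin EFin_normr_Rintegral//.
  apply: (le_trans (le_abse_integral _ _ _)) => //.
    exact: (measurable_int _ iJ).
  apply: ge0_subset_integral => //.
    by apply/measurable_EFinP; exact: measurableT_comp.
  move=> z /=; rewrite !in_itv/= => /andP[az zb].
  by rewrite (lt_trans (an_gt n Ax) az) (lt_trans zb (bn_lt n Ax)).
have mJ n : measurable_fun (A : set plane) (J n).
  exact: (measurable_fubini_band oA (@can n) (@cbn n) (intfn n)).
have [iJ cJ] := Rintegral_dominated_convergence mA mJ cJx iIabs leJ.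
have JI n : \int[lambda2 R]_(x in A) J n x =
    \int[lambda3 R]_(p in band A a b)
      ((fun p : space => f p.1 p.2) \_ (band A (an n) (bn n))) p.
  rewrite -Rintegral_mkcondr setIidr; last exact: sub_n.
  exact: (Rintegral_fubini_band oA (@can n) (@cbn n) (intfn n)).
have iabs : (lambda3 R).-integrable (band A a b) (fun p => `|(f p.1 p.2)%:E|%E).
  exact: integrable_abse.
have ev_in (x : R * R) (z : R) : band A a b (x, z) ->
    ((fun p : space => f p.1 p.2) \_ (band A (an n) (bn n))) (x, z)
      @[n --> \oo] --> f x z.
  move=> [/= Ax /andP[az zb]]; apply: cvg_near_cst.
  have naz : \forall n \near \oo, an n x < z by exact: (cvgr_lt _ (@an_cvg x)).
  have nzb : \forall n \near \oo, z < bn n x by exact: (cvgr_gt _ (@bn_cvg x)).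
  near=> n; rewrite patchE mem_set//; split => //=.
  by apply/andP; split; near: n.
have [|||_ cI] := @Rintegral_dominated_convergence _ _ _ (lambda3 R) (band A a b)
  (fun n => (fun p : space => f p.1 p.2) \_ (band A (an n) (bn n)))
  (fun p => f p.1 p.2) _ mab _ _ iabs.
- move=> n; apply/(measurable_restrict (fun p : space => f p.1 p.2) (mabn n) mab).
  rewrite setIidr; last exact: sub_n.
  by have /measurable_EFinP := measurable_int _ (intfn n).
- by move=> p; exact: (ev_in p.1 p.2).
- move=> n p abp; rewrite patchE; case: ifPn => // _.
  by rewrite abse0 abse_ge0.
have E : \int[lambda2 R]_(x in A) (ga x - gb x) =
    \int[lambda3 R]_(p in band A a b) f p.1 p.2.
  by move: cJ; rewrite (funext JI) => cJ; exact: cvg_unique cJ cI.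
have gE : (fun x => gb x - ga x) = (fun x => -1 * (ga x - gb x)).
  by apply/funext => x; rewrite mulN1r opprB.
split.
  have := integrable_EFinN iJ.
  by under [X in EFin \o X]eq_fun do rewrite opprB.
by rewrite gE RintegralZl// E mulN1r.
Unshelve. all: by end_near. Qed.
End ColumnFlux.
End VerticalFlux.

(** * Splines, steps and cutoffs on the line *)

Section Splines.
Context {R : realType}.
Implicit Types s : R.

Definition ramp s : R := Num.max s 0.

Lemma rampE s : ramp s = if 0 <= s then s else 0.
Proof. by rewrite /ramp; case: ifPn => [/max_l//|]; rewrite -ltNge => /ltW/max_r. Qed.

Lemma continuous_ramp : continuous ramp.
Proof. by move=> s; apply: continuous_max; [exact: cvg_id|exact: cvg_cst]. Qed.

(** The only non-smooth point is 0, where the difference quotient is at most |h|. *)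
Lemma is_derive_ramp2 s : is_derive s 1 (fun t => ramp t ^+ 2) (2 * ramp s).
Proof.
have [s0|s0|->] := ltgtP s 0.
- rewrite [ramp _]rampE leNgt s0/= mulr0.
  apply: (@near_eq_is_derive _ _ _ (cst 0)) => //; last first.
  + near=> t; rewrite /= rampE leNgt ifF ?expr0n//.
    by apply/negbTE; rewrite negbK; near: t; exact: lt_nbhsl.
- rewrite [ramp _]rampE (ltW s0).
  apply: (@near_eq_is_derive _ _ _ (fun t : R => t ^+ 2 : R)).
  + near=> t; rewrite /= rampE ifT//; apply/ltW; near: t; exact: lt_nbhsr.
  + apply: is_derive_eq. by rewrite /= [_%:A]mulr1 mulr_natl mulr2n.
- rewrite [ramp _]rampE lexx mulr0; apply/is_derive_quotient.
  have norm0 : `|h : R| @[h --> 0^'] --> (0 : R).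
    rewrite -[X in _ --> X](@normr0 R R); apply: cvg_norm.
    exact: cvg_within_filter (@cvg_id _ _).
  apply: (@squeeze_cvgr _ _ _ _ (fun h => - `|h|) (fun h => `|h|)).
  + near=> h; rewrite addr0 [ramp 0]rampE lexx expr0n subr0 -ler_norml.
    rewrite normrM normfV normrX ler_pdivrMl ?normr_gt0; last first.
      by near: h; exact: nbhs_dnbhs_neq.
    rewrite -expr2 ler_sqr ?nnegrE// rampE; case: ifP => // _.
    by rewrite normr0.
  + by rewrite -[X in _ --> X]oppr0; exact: cvgN.
  + exact: norm0.
Unshelve. all: by end_near. Qed.

(** The integral of the hat function supported by [0, 2]: it rises from 0 to 1
    between 0 and 2, and is C^1. *)
Definition step s : R :=
  2^-1 * (ramp s ^+ 2 - 2 * ramp (s - 1) ^+ 2 + ramp (s - 2) ^+ 2).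

Definition hat s : R := ramp s - 2 * ramp (s - 1) + ramp (s - 2).

Lemma is_derive_step s : is_derive s 1 step (hat s).
Proof.
have sh c : is_derive s 1 (fun t => ramp (t - c) ^+ 2) (2 * ramp (s - c)).
  have := @is_derive1_comp _ (fun t => ramp t ^+ 2) (fun t => t - c) s _ 1
    (is_derive_ramp2 (s - c)) _.
  rewrite mulr1; apply; apply: is_derive_eq.
  by rewrite subr0.
have := sh 0; rewrite subr0; under eq_fun do rewrite subr0.
move=> sh0; have sh1 := sh 1; have sh2 := sh 2.
rewrite /step; apply: is_derive_eq.
by rewrite /hat /GRing.scale/=; field.
Qed.

Lemma continuous_hat : continuous hat.
Proof.
have sh c : continuous (fun s => ramp (s - c)).
  move=> s; apply: (@continuous_comp R R R (fun t => t - c) ramp);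
    last exact: continuous_ramp.
  by apply: cvgB; [exact: cvg_id|exact: cvg_cst].
move=> s; apply: cvgD; last exact: sh.
by apply: cvgB; [exact: continuous_ramp|apply: cvgM; [exact: cvg_cst|exact: sh]].
Qed.

Lemma step_bounds s : 0 <= step s <= 1.
Proof.
rewrite /step !rampE; case: ifPn => s0; case: ifPn => s1; case: ifPn => s2;
  try lra; apply/andP; split; nra.
Qed.

Lemma hat_bounds s : 0 <= hat s <= 1.
Proof.
by rewrite /hat !rampE; case: ifPn => s0; case: ifPn => s1; case: ifPn => s2; lra.
Qed.

Lemma step_le0 s : s <= 0 -> step s = 0.
Proof.
by move=> h; rewrite /step !rampE; do 3 (case: ifPn => ?); nra.
Qed.

Lemma step_ge2 s : 2 <= s -> step s = 1.
Proof.
by move=> h; rewrite /step !rampE; do 3 (case: ifPn => ?); nra.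
Qed.

Lemma hat_out s : s <= 0 \/ 2 <= s -> hat s = 0.
Proof.
by move=> [] h; rewrite /hat !rampE; do 3 (case: ifPn => ?); lra.
Qed.

End Splines.

Section TestFunctions.
Context {R : realType}.
Implicit Types (X Y : R -> R) (s c d : R).

(** The derivative is an explicit function, so that bounds and supports can be
    stated for [X] and [X'] alike. *)
Definition test X X' := [/\ forall s, is_derive s 1 X (X' s), continuous X' &
  exists M, forall s, `|X s| <= M /\ `|X' s| <= M].

Lemma test_continuous X X' : test X X' -> continuous X.
Proof.
case=> dX _ _ s; apply/differentiable_continuous/derivable1_diffP.
by case: (dX s).
Qed.

Lemma test_mul X X' Y Y' : test X X' -> test Y Y' ->
  test (fun s => X s * Y s) (fun s => X' s * Y s + X s * Y' s).
Proof.
move=> tX tY; have cX := test_continuous tX; have cY := test_continuous tY.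
case: tX => dX cX' [M hM]; case: tY => dY cY' [N hN]; split.
- move=> s; have dXs := dX s; have dYs := dY s; apply: is_derive_eq.
  by rewrite /GRing.scale/= addrC mulrC.
- move=> s; apply: cvgD; apply: cvgM;
    by [exact: cX'|exact: cY|exact: cX|exact: cY'].
- have M0 : 0 <= M by exact: le_trans (hM 0).1.
  exists (M * N + M * N) => s; have [hX hX'] := hM s; have [hY hY'] := hN s.
  split.
    rewrite normrM (@le_trans _ _ (M * N)) ?ler_pM// lerDl mulr_ge0//.
    by exact: le_trans hY.
  by rewrite (le_trans (ler_normD _ _))// lerD// normrM ler_pM.
Qed.

Lemma test_sub X X' Y Y' : test X X' -> test Y Y' ->
  test (fun s => X s - Y s) (fun s => X' s - Y' s).
Proof.
case=> dX cX' [M hM] [dY cY' [N hN]]; split.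
- by move=> s; have dXs := dX s; have dYs := dY s; apply: is_derive_eq.
- by move=> s; apply: cvgB; [exact: cX'|exact: cY'].
- exists (M + N) => s; have [hX hX'] := hM s; have [hY hY'] := hN s.
  by split; rewrite (le_trans (ler_normB _ _))// lerD.
Qed.

Lemma test_step c d : 0 < d ->
  test (fun s => step ((s - c) / d)) (fun s => hat ((s - c) / d) / d).
Proof.
move=> d0; split.
- move=> s; have dlin : is_derive s 1 (fun t => (t - c) / d) d^-1.
    have -> : (fun t : R => (t - c) / d) = (fun t => d^-1 *: (t - c)).
      by apply/funext => t; rewrite mulrC.
    by apply: is_derive_eq; rewrite subr0 /GRing.scale/= mulr1.
  exact: (is_derive1_comp (is_derive_step _) dlin).
- move=> s; apply: cvgM; last exact: cvg_cst.
  apply: (@continuous_comp R R R (fun t => (t - c) / d) hat).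
    apply: cvgM; last exact: cvg_cst.
    by apply: cvgB; [exact: cvg_id|exact: cvg_cst].
  exact: continuous_hat.
- exists (1 + d^-1) => s; have /andP[s0 s1] := step_bounds ((s - c) / d).
  have /andP[h0 h1] := hat_bounds ((s - c) / d).
  have d0' : 0 < d^-1 by rewrite invr_gt0.
  split; first by rewrite ger0_norm// (le_trans s1)// lerDl ltW.
  rewrite normrM !ger0_norm ?(ltW d0')// (@le_trans _ _ d^-1) ?lerDr//.
  by rewrite ler_piMl// ltW.
Qed.

(** The quadratic B-spline with knots c, c + d, c + 2 d and c + 3 d. *)
Definition bump c d s := step ((s - c) / d) - step ((s - (c + d)) / d).
Definition bump' c d s := hat ((s - c) / d) / d - hat ((s - (c + d)) / d) / d.

Lemma test_bump c d : 0 < d -> test (bump c d) (bump' c d).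
Proof. by move=> d0; apply: test_sub; exact: test_step. Qed.

Lemma bump_out c d s : 0 < d -> ~~ (c <= s <= c + 3 * d) ->
  bump c d s = 0 /\ bump' c d s = 0.
Proof.
move=> d0; rewrite negb_and -!ltNge /bump /bump' => /orP[sc|cs].
  rewrite !step_le0 ?hat_out ?mul0r ?subrr//.
  - by left; rewrite pmulr_lle0 ?invr_gt0//; lra.
  - by left; rewrite pmulr_lle0 ?invr_gt0//; lra.
  - by rewrite pmulr_lle0 ?invr_gt0//; lra.
  - by rewrite pmulr_lle0 ?invr_gt0//; lra.
rewrite !step_ge2 ?hat_out ?mul0r ?subrr//.
- by right; rewrite ler_pdivlMr//; lra.
- by right; rewrite ler_pdivlMr//; lra.
- by rewrite ler_pdivlMr//; lra.
- by rewrite ler_pdivlMr//; lra.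
Qed.

(** The translates by multiples of d telescope. *)
Lemma sum_bump c d (M : nat) s : 0 < d ->
  c + 2 * d <= s <= c + M%:R * d ->
  \sum_(i < M) bump (c + i%:R * d) d s = 1 /\
  \sum_(i < M) bump' (c + i%:R * d) d s = 0.
Proof.
move=> d0 /andP[cs sM].
pose u (i : nat) := - step ((s - (c + i%:R * d)) / d).
pose v (i : nat) := - (hat ((s - (c + i%:R * d)) / d) / d).
have next (i : nat) : c + i%:R * d + d = c + i.+1%:R * d.
  by rewrite -addrA -natr1 mulrDl mul1r.
split.
  have -> : \sum_(i < M) bump (c + i%:R * d) d s = u M - u 0%N.
    rewrite -(telescope_sumr _ (leq0n M)) big_mkord; apply: eq_bigr => i _.
    by rewrite /u /bump next opprK addrC.
  rewrite /u mul0r addr0 opprK addrC step_ge2 ?step_le0 ?subr0//.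
  - by rewrite pmulr_lle0 ?invr_gt0//; lra.
  - by rewrite ler_pdivlMr//; lra.
have -> : \sum_(i < M) bump' (c + i%:R * d) d s = v M - v 0%N.
  rewrite -(telescope_sumr _ (leq0n M)) big_mkord; apply: eq_bigr => i _.
  by rewrite /v /bump' next opprK addrC.
rewrite /v mul0r addr0 opprK addrC !hat_out ?mul0r ?subrr//.
- by left; rewrite pmulr_lle0 ?invr_gt0//; lra.
- by right; rewrite ler_pdivlMr//; lra.
Qed.

(** Equal to 1 on [- N, N] and to 0 outside [- N - 2, N + 2], with a derivative
    bounded independently of N. *)
Definition cutoff (N : nat) s := step ((s - (- N%:R - 2)) / 1) - step ((s - N%:R) / 1).
Definition cutoff' (N : nat) s :=
  hat ((s - (- N%:R - 2)) / 1) / 1 - hat ((s - N%:R) / 1) / 1.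

Lemma test_cutoff N : test (cutoff N) (cutoff' N).
Proof. by apply: test_sub; exact: test_step. Qed.

Lemma cutoff_in N s : `|s| <= N%:R -> cutoff N s = 1 /\ cutoff' N s = 0.
Proof.
rewrite ler_norml => /andP[Ns sN]; rewrite /cutoff /cutoff' !divr1.
by rewrite step_ge2 ?step_le0 ?hat_out ?hat_out ?subr0 ?subrr//;
  [left|right|..]; lra.
Qed.

Lemma cutoff_out N s : N%:R + 2 <= `|s| -> cutoff N s = 0 /\ cutoff' N s = 0.
Proof.
rewrite /cutoff /cutoff' !divr1 ler_normr => /orP[] h.
  have := ler0n R N => N0.
  by rewrite !step_ge2 ?hat_out ?hat_out ?subrr//; [right|right|..]; lra.
have := ler0n R N => N0.
by rewrite !step_le0 ?hat_out ?hat_out ?subrr//; [left|left|..]; lra.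
Qed.

Lemma cutoff_bounds N s : `|cutoff N s| <= 1 /\ `|cutoff' N s| <= 1.
Proof.
have bnd a b : 0 <= a <= 1 -> 0 <= b <= 1 -> `|a - b| <= 1 :> R.
  by move=> /andP[? ?] /andP[? ?]; rewrite ler_norml; lra.
by rewrite /cutoff /cutoff' !divr1; split; apply: bnd;
  by [exact: step_bounds|exact: hat_bounds].
Qed.

End TestFunctions.

(** * Partial derivatives in the plane *)

Section PlanePartials.
Context {R : realType}.
Implicit Types (f : R * R -> R) (x y : R * R).

Lemma continuous_comp_fst (u : R -> R) : continuous u ->
  continuous (fun x : R * R => u x.1).
Proof.
move=> cu x; apply: (@continuous_comp (R * R)%type R R fst u); last exact: cu.
exact: (@cvg_fst _ _ (nbhs x.1) (nbhs x.2) _).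
Qed.

Lemma continuous_comp_snd (u : R -> R) : continuous u ->
  continuous (fun x : R * R => u x.2).
Proof.
move=> cu x; apply: (@continuous_comp (R * R)%type R R snd u); last exact: cu.
exact: (@cvg_snd _ _ (nbhs x.1) (nbhs x.2) _).
Qed.

(** In terms of one-dimensional derivatives along the coordinate lines, to which
    the product and chain rules on the line apply. *)
Definition partials f f1 f2 x :=
  is_derive x.1 1 (fun s => f (s, x.2)) (f1 x) /\
  is_derive x.2 1 (fun s => f (x.1, s)) (f2 x).

Lemma C1_on_partials (U : set (R * R)) f : C1_on U f ->
  forall x, U x -> partials f (partial1 f) (partial2 f) x.
Proof.
move=> [df _] [x1 x2] /df[d1 d2].
split; apply/is_derive_quotient.
  have E : (fun h : R => h^-1 *: ((f \o shift (x1, x2)) (h *: (1, 0)) - f (x1, x2))) =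
      (fun h => h^-1 * (f (h + x1, x2) - f (x1, x2))).
    apply/funext => h /=; congr (_ * (f _ - _)).
    by apply/pair_equal_spec; rewrite /= [h *: 1]mulr1 scaler0 add0r.
  by rewrite -E; exact: d1.
have E : (fun h : R => h^-1 *: ((f \o shift (x1, x2)) (h *: (0, 1)) - f (x1, x2))) =
    (fun h => h^-1 * (f (x1, h + x2) - f (x1, x2))).
  apply/funext => h /=; congr (_ * (f _ - _)).
  by apply/pair_equal_spec; rewrite /= [h *: 1]mulr1 scaler0 add0r.
by rewrite -E; exact: d2.
Qed.

Lemma mean_value_dist (g g' : R -> R) (a b M : R) :
  (forall s, Num.min a b <= s <= Num.max a b ->
    is_derive s 1 g (g' s) /\ `|g' s| <= M) ->
  `|g b - g a| <= M * `|b - a|.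
Proof.
wlog ab : a b / a <= b => [th dg|].
  have [/th|/ltW/th] := leP a b; first exact.
  by rewrite distrC minC maxC [`|b - a|]distrC; exact.
rewrite (min_l ab) (max_r ab) => dg; rewrite [`|b - a|]ger0_norm ?subr_ge0//.
apply: mean_value_le => // [s|s /andP[sa sb]].
  rewrite in_itv/= => /dg[[ds _] _].
  exact/differentiable_continuous/derivable1_diffP.
have [[ds ge] gM] : is_derive s 1 g (g' s) /\ `|g' s| <= M.
  by apply: dg; rewrite !ltW.
by split => //; rewrite derive1E ge.
Qed.

(** The mean value theorem along two sides of a small rectangle, on which both
    partial derivatives are bounded. *)
Lemma partials_continuous (U : set (R * R)) f f1 f2 : open U ->
  (forall x, U x -> partials f f1 f2 x) ->
  {in U, continuous f1} -> {in U, continuous f2} -> {in U, continuous f}.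
Proof.
move=> oU df cf1 cf2 x /set_mem Ux.
have cf1x : f1 @ x --> f1 x by apply: cf1; exact: mem_set.
have cf2x : f2 @ x --> f2 x by apply: cf2; exact: mem_set.
pose M := `|f1 x| + `|f2 x| + 1.
have M0 : 0 < M by rewrite /M ltr_wpDl// addr_ge0.
have : \forall y \near x, [/\ U y, `|f1 y| <= M & `|f2 y| <= M].
  near=> y; split; first by near: y; exact: open_nbhs_nbhs.
    near: y; apply: (cvgr_norm_le _ cf1x); rewrite /M; have := normr_ge0 (f2 x); lra.
  near: y; apply: (cvgr_norm_le _ cf2x); rewrite /M; have := normr_ge0 (f1 x); lra.
move=> /nbhs_ballP[r /= r0 rU].
apply/cvgrPdist_le => e e0.
have d0 : 0 < e / (2 * M) by rewrite divr_gt0// mulr_gt0.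
near=> y.
have yd : ball x (e / (2 * M)) y by near: y; exact: (nbhsx_ballx x _ d0).
have yr : ball x r y by near: y; exact: (nbhsx_ballx x _ r0).
have between (a b s : R) : ball a r b -> Num.min a b <= s <= Num.max a b -> ball a r s.
  rewrite /ball/= => abr /andP[]; rewrite ge_min le_max => h1 h2.
  move: abr; rewrite !ltr_norml.
  by case: (leP a b) h1 h2 => ab /orP[] h1 /orP[] h2; lra.
have step1 : `|f (y.1, y.2) - f (x.1, y.2)| <= M * `|y.1 - x.1|.
  apply: (@mean_value_dist (fun s => f (s, y.2)) (fun s => f1 (s, y.2))) => s xys.
  have [Us b1 _] : [/\ U (s, y.2), `|f1 (s, y.2)| <= M & `|f2 (s, y.2)| <= M].
    by apply: rU; split; [exact: between yr.1 xys|exact: yr.2].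
  by split => //; exact: (df _ Us).1.
have step2 : `|f (x.1, y.2) - f (x.1, x.2)| <= M * `|y.2 - x.2|.
  apply: (@mean_value_dist (fun s => f (x.1, s)) (fun s => f2 (x.1, s))) => s xys.
  have [Us _ b2] : [/\ U (x.1, s), `|f1 (x.1, s)| <= M & `|f2 (x.1, s)| <= M].
    by apply: rU; split; [exact: ballxx|exact: between yr.2 xys].
  by split => //; exact: (df _ Us).2.
have near1 : `|y.1 - x.1| <= e / (2 * M) by rewrite distrC; exact: ltW yd.1.
have near2 : `|y.2 - x.2| <= e / (2 * M) by rewrite distrC; exact: ltW yd.2.
have -> : f x - f y = - ((f (y.1, y.2) - f (x.1, y.2)) +
    (f (x.1, y.2) - f (x.1, x.2))).
  by rewrite -!surjective_pairing; ring.
rewrite normrN (le_trans (ler_normD _ _))// (le_trans (lerD step1 step2))//.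
rewrite -mulrDr (@le_trans _ _ (M * (e / (2 * M) + e / (2 * M))))//.
  by rewrite ler_wpM2l ?(ltW M0)// lerD.
by rewrite le_eqVlt; apply/orP; left; apply/eqP; field; rewrite gt_eqF.
Unshelve. all: by end_near. Qed.

End PlanePartials.

(** * The divergence of a compactly supported field has integral zero *)

Section CompactlySupported.
Context {R : realType}.
Local Notation Rm := (measurableTypeR R).
Local Notation plane := (Rm * Rm)%type.
Local Notation leb := (@lebesgue_measure R).

Lemma continuous_pairr (s : R) : continuous (fun z : R => (s, z)).
Proof.
by move=> z; apply: (@cvg_pair _ _ _ (nbhs z) (nbhs s) (nbhs z));
  [exact: cvg_cst|exact: cvg_id].
Qed.

Lemma continuous_pairl (s : R) : continuous (fun z : R => (z, s)).
Proof.
by move=> z; apply: (@cvg_pair _ _ _ (nbhs z) (nbhs z) (nbhs s));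
  [exact: cvg_id|exact: cvg_cst].
Qed.

Lemma integral_derivative_compact (H h : R -> R) (K : R) : continuous h ->
  (forall s : R, is_derive s 1 H (h s)) ->
  (forall s : R, K < `|s| -> H s = 0 /\ h s = 0) ->
  (\int[leb]_s (h s)%:E = 0)%E.
Proof.
move=> ch dH out; pose K1 := `|K| + 1.
have KK1 : K < K1 by rewrite /K1 (le_lt_trans (ler_norm K))// ltrDl.
have K10 : 0 < K1 by rewrite /K1 ltr_wpDl.
have hE : derive1 H = h.
  by apply/funext => s; rewrite derive1E (@derive_val _ _ _ _ _ _ _ (dH s)).
have [|||iH IH] := @Rintegral_derive1 R H (- K1) K1.
- by rewrite -subr_gt0 opprK addr_gt0.
- by move=> s _; case: (dH s).
- by move=> s _; rewrite hE; exact: ch.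
have -> : (\int[leb]_s (h s)%:E = \int[leb]_(s in `](- K1)%R, K1[) (h s)%:E)%E.
  rewrite [RHS]integral_mkcond; apply: eq_integral => s _; rewrite patchE.
  case: ifPn => // /negP sK; rewrite (out s _).2// (lt_le_trans KK1)//.
  rewrite leNgt; apply/negP; rewrite ltr_norml => sK1; apply: sK.
  by apply/mem_set; rewrite /= in_itv.
rewrite hE in iH IH.
rewrite -[LHS]fineK; last exact: integrable_fin_num.
rewrite -[fine _]/(\int[leb]_(s in `]- K1, K1[) h s) IH (out K1 _).1.
  by rewrite (out (- K1) _).1 ?subrr// normrN gtr0_norm.
by rewrite gtr0_norm.
Qed.

Lemma integrable_compact_support (g : R * R -> R) (K : R) : continuous g ->
  (forall x : R * R, K < `|x.1| \/ K < `|x.2| -> g x = 0) ->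
  (lambda2 R).-integrable [set: plane] (EFin \o g).
Proof.
move=> cg out.
pose Q := `[- K, K]%classic `*` `[- K, K]%classic : set (R * R).
have mg : measurable_fun [set: plane] g.
  by apply: continuous_plane_measurable; [exact: openT|move=> x _; exact: cg].
have mQ : measurable (Q : set plane) by apply: measurableX; exact: measurable_itv.
have outQ x : ~ Q x -> g x = 0.
  move=> nQ; apply: out; apply: contrapT => /not_orP[/negP + /negP].
  rewrite -!leNgt !ler_norml.
  by move=> h1 h2; apply: nQ; split; rewrite /= in_itv.
have [[x0 Qx0]|Q0] := pselect (Q !=set0); last first.
  apply: (eq_integrable _ (cst 0%E)) => //; last exact: integrable0.
  by move=> x _; rewrite /= outQ// => Qx; apply: Q0; exists x.
have [c _ gc] : exists2 c, c \in Q & forall x, x \in Q -> `|g x| <= `|g c|.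
  apply: (@compact_EVT_max _ _ (fun x => `|g x|)); first by exists x0.
    by apply: compact_setX; exact: segment_compact.
  by apply: continuous_subspaceT => x; apply: cvg_norm; exact: cg.
have iQ : (lambda2 R).-integrable Q (EFin \o g).
  apply: (@le_integrable _ _ _ (lambda2 R) Q mQ _ (EFin \o cst `|g c|)).
  - by apply/measurable_EFinP; exact: measurable_funTS.
  - by move=> x Qx; rewrite /= lee_fin normr_id; apply: gc; exact/mem_set.
  - apply/integrableP; split; first by apply/measurable_EFinP; exact: measurable_cst.
    under eq_integral do rewrite /= normr_id.
    rewrite integral_cst// lte_mul_pinfty ?lee_fin//.
    rewrite [X in (X < _)%E](_ : _ = leb `[(- K)%R, K] * leb `[(- K)%R, K])%E;
      last by apply: product_measure1E; exact: measurable_itv.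
    have side : (leb `[(- K)%R, K]%classic < +oo)%E.
      by rewrite lebesgue_measure_itv/=; case: ifP => _; rewrite ltry.
    by rewrite lte_mul_pinfty// ge0_fin_numE.
have -> : EFin \o g = (EFin \o g) \_ Q.
  apply/funext => x; rewrite patchE; case: ifPn => // /negP xQ.
  by rewrite /= outQ// => Qx; apply: xQ; exact/mem_set.
by move/(integrable_mkcond _ mQ) : iQ.
Qed.

Lemma Rintegral_partials_compact (G1 G2 g1 g2 : R * R -> R) (K : R) :
  continuous g1 -> continuous g2 ->
  (forall x : R * R, is_derive x.1 1 (fun s => G1 (s, x.2)) (g1 x)) ->
  (forall x : R * R, is_derive x.2 1 (fun s => G2 (x.1, s)) (g2 x)) ->
  (forall x : R * R, K < `|x.1| \/ K < `|x.2| ->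
    [/\ G1 x = 0, G2 x = 0, g1 x = 0 & g2 x = 0]) ->
  (lambda2 R).-integrable [set: plane] (EFin \o (fun x => g1 x + g2 x)) /\
  \int[lambda2 R]_x (g1 x + g2 x) = 0.
Proof.
move=> cg1 cg2 d1 d2 out.
have i1 : (lambda2 R).-integrable [set: plane] (EFin \o g1).
  by apply: (integrable_compact_support (K := K)) => // x /out[].
have i2 : (lambda2 R).-integrable [set: plane] (EFin \o g2).
  by apply: (integrable_compact_support (K := K)) => // x /out[].
split; first exact: integrable_EFinD.
rewrite RintegralD// /Rintegral.
rewrite -(@integral21_prod_meas1 _ _ Rm Rm R leb leb _ i1).
rewrite -(@integral12_prod_meas1 _ _ Rm Rm R leb leb _ i2).
rewrite integral0_eq ?integral0_eq ?addr0//.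
- move=> s _; apply: (@integral_derivative_compact (fun z => G2 (s, z)) _ K).
  + move=> z; apply: (@continuous_comp _ _ _ (fun z => (s, z)) g2); last exact: cg2.
    exact: continuous_pairr.
  + by move=> z; exact: (d2 (s, z)).
  + by move=> z zK; have [] := out (s, z) (or_intror zK).
- move=> s _; apply: (@integral_derivative_compact (fun z => G1 (z, s)) _ K).
  + move=> z; apply: (@continuous_comp _ _ _ (fun z => (z, s)) g1); last exact: cg1.
    exact: continuous_pairl.
  + by move=> z; exact: (d1 (z, s)).
  + by move=> z zK; have [] := out (z, s) (or_introl zK).
Qed.

End CompactlySupported.

(** * Cutting a field off near the boundary of its domain *)

Section InnerCutoff.
Context {R : realType}.
Local Notation Rm := (measurableTypeR R).
Local Notation plane := (Rm * Rm)%type.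
Local Notation leb := (@lebesgue_measure R).

Variables (U V Q : set (R * R)) (psi p1 p2 F1 F2 f1 f2 : R * R -> R).
Variables (X X' Y Y' : R -> R) (K eps : R).
Hypothesis oU : open U.
Hypothesis oV : open V.
Hypothesis dpsi : forall x, U x -> partials psi p1 p2 x.
Hypothesis cp1 : {in U, continuous p1}.
Hypothesis cp2 : {in U, continuous p2}.
Hypothesis VU : V `<=` U.
Hypothesis psi_ge0 : forall x, U x -> ~ V x -> 0 <= psi x.
Hypothesis dF1 : forall x : R * R, V x -> is_derive x.1 1 (fun s => F1 (s, x.2)) (f1 x).
Hypothesis dF2 : forall x : R * R, V x -> is_derive x.2 1 (fun s => F2 (x.1, s)) (f2 x).
Hypothesis cF1 : {in V, continuous F1}.
Hypothesis cF2 : {in V, continuous F2}.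
Hypothesis cf1 : {in V, continuous f1}.
Hypothesis cf2 : {in V, continuous f2}.
Hypothesis tX : test X X'.
Hypothesis tY : test Y Y'.
Hypothesis cQ : closed Q.
Hypothesis QU : Q `<=` U.
Hypothesis XYQ : forall x, ~ Q x ->
  (X x.1 = 0 /\ X' x.1 = 0) \/ (Y x.2 = 0 /\ Y' x.2 = 0).
Hypothesis QK : forall x : R * R, K < `|x.1| \/ K < `|x.2| -> ~ Q x.
Hypothesis eps0 : 0 < eps.

(** Equal to 1 where psi <= - 3 eps and to 0 where - eps <= psi. *)
Definition inner (x : R * R) : R := 1 - step (psi x / eps + 3).
(** The factor of grad psi in the gradient of [inner]. *)
Definition inner' (x : R * R) : R := - (hat (psi x / eps + 3) / eps).

Let cX : continuous X. Proof. exact: test_continuous tX. Qed.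
Let cY : continuous Y. Proof. exact: test_continuous tY. Qed.
Let cX' : continuous X'. Proof. by case: tX. Qed.
Let cY' : continuous Y'. Proof. by case: tY. Qed.

Let cpsi : {in U, continuous psi}.
Proof. exact: partials_continuous oU dpsi cp1 cp2. Qed.

Let cstep : continuous (@step R).
Proof.
move=> s; apply/differentiable_continuous/derivable1_diffP.
by case: (is_derive_step s).
Qed.

Let cinner : {in U, continuous inner}.
Proof.
move=> x Ux; apply: cvgB; first exact: cvg_cst.
apply: (@cvg_comp _ _ _ (fun y => psi y / eps + 3) step _ (nbhs (psi x / eps + 3)));
  last exact: cstep.
by apply: cvgD; [apply: cvgM; [exact: cpsi|exact: cvg_cst]|exact: cvg_cst].
Qed.

Let cinner' : {in U, continuous inner'}.
Proof.
move=> x Ux; apply: cvgN; apply: cvgM; last exact: cvg_cst.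
apply: (@cvg_comp _ _ _ (fun y => psi y / eps + 3) hat _ (nbhs (psi x / eps + 3)));
  last exact: continuous_hat.
by apply: cvgD; [apply: cvgM; [exact: cpsi|exact: cvg_cst]|exact: cvg_cst].
Qed.

Let is_derive_inner (u : R -> R) (s du : R) : is_derive s 1 u du ->
  is_derive s 1 (fun t => 1 - step (u t / eps + 3))
    (- (hat (u s / eps + 3) / eps) * du).
Proof.
move=> duP.
have dlin : is_derive s 1 (fun t => u t / eps + 3) (du / eps).
  have -> : (fun t : R => u t / eps + 3) = (fun t => eps^-1 *: u t + 3).
    by apply/funext => t; rewrite /GRing.scale/= mulrC.
  by apply: is_derive_eq; rewrite addr0 /GRing.scale/= mulrC.
have dst := is_derive1_comp (is_derive_step _) dlin.
by apply: is_derive_eq; ring.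
Qed.

(* Off V, either Q stays at a positive distance, or psi >= 0 and inner is 0 nearby:
   in both cases the extension by zero is smooth. *)
Let vanish x : ~ V x -> \forall y \near x, V y ->
  [\/ X y.1 = 0 /\ X' y.1 = 0, Y y.2 = 0 /\ Y' y.2 = 0 |
      inner y = 0 /\ inner' y = 0].
Proof.
move=> nVx; have [Qx|nQx] := pselect (Q x); last first.
  have : \forall y \near x, ~ Q y.
    by apply: open_nbhs_nbhs; split => //; exact: closed_openC.
  by apply: filterS => y /XYQ[] h _; [exact: Or31|exact: Or32].
have Ux := QU Qx; have psix := psi_ge0 Ux nVx.
have cpx : psi @ x --> psi x by apply: cpsi; exact: mem_set.
have : \forall y \near x, - eps < psi y.
  by apply: (cvgr_gt _ cpx); rewrite (lt_le_trans _ psix)// oppr_lt0.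
apply: filterS => y epsy _; apply: Or33; rewrite /inner /inner'.
have h : 2 <= psi y / eps + 3.
  by rewrite -lerBlDr ler_pdivlMr//; lra.
by rewrite step_ge2// hat_out ?subrr ?mul0r ?oppr0//; right.
Qed.

Let cXp := continuous_comp_fst cX.
Let cX'p := continuous_comp_fst cX'.
Let cYp := continuous_comp_snd cY.
Let cY'p := continuous_comp_snd cY'.

Let restrict_continuous (u : R * R -> R) : {in V, continuous u} ->
  (forall x, ~ V x -> \forall y \near x, V y -> u y = 0) -> continuous (u \_ V).
Proof.
move=> cu u0 x; have [Vx|nVx] := pselect (V x).
  have nE : \forall y \near x, u y = (u \_ V) y.
    have : \forall y \near x, V y by exact: open_nbhs_nbhs.
    by apply: filterS => y Vy; rewrite patchE mem_set.
  rewrite /continuous_at [X in _ --> X]patchE (mem_set Vx).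
  by apply: cvg_trans (cu x (mem_set Vx)); exact: near_eq_cvg.
have nE : \forall y \near x, 0 = (u \_ V) y.
  have := u0 x nVx; apply: filterS => y uy; rewrite patchE; case: ifPn => //.
  by move=> /set_mem /uy.
rewrite /continuous_at [X in _ --> X]patchE ifF; last by apply/negP => /set_mem.
by apply: cvg_near_cst; move: nE; apply: filterS => y <-.
Qed.

Let restrict_derive (m : R -> R * R) (s : R) (u : R * R -> R) (d : R) :
  continuous m ->
  (V (m s) -> is_derive s 1 (u \o m) d) ->
  (forall x, ~ V x -> \forall y \near x, V y -> u y = 0) ->
  (~ V (m s) -> d = 0) ->
  is_derive s 1 ((u \_ V) \o m) d.
Proof.
move=> cm du u0 d0; have [Vx|nVx] := pselect (V (m s)).
  apply: near_eq_is_derive (du Vx).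
  have : \forall t \near s, V (m t) by exact: (cm s V (open_nbhs_nbhs (conj oV Vx))).
  by apply: filterS => t Vt; rewrite /= patchE mem_set.
have nz : \forall t \near s, cst 0 t = ((u \_ V) \o m) t.
  have : \forall t \near s, V (m t) -> u (m t) = 0 by exact: (cm s _ (u0 _ nVx)).
  apply: filterS => t ut; rewrite /= patchE; case: ifPn => //.
  by move=> /set_mem /ut.
rewrite (d0 nVx); exact: near_eq_is_derive nz (is_derive_cst (0 : R) s 1).
Qed.

Let G1 x := X x.1 * Y x.2 * inner x * F1 x.
Let G2 x := X x.1 * Y x.2 * inner x * F2 x.
Let g1 x := X' x.1 * Y x.2 * inner x * F1 x +
  X x.1 * Y x.2 * (inner' x * p1 x) * F1 x + X x.1 * Y x.2 * inner x * f1 x.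
Let g2 x := X x.1 * Y' x.2 * inner x * F2 x +
  X x.1 * Y x.2 * (inner' x * p2 x) * F2 x + X x.1 * Y x.2 * inner x * f2 x.

Let vanish4 y : [\/ X y.1 = 0 /\ X' y.1 = 0, Y y.2 = 0 /\ Y' y.2 = 0 |
      inner y = 0 /\ inner' y = 0] ->
  [/\ G1 y = 0, G2 y = 0, g1 y = 0 & g2 y = 0].
Proof.
by rewrite /G1 /G2 /g1 /g2 => -[] [-> ->]; rewrite ?(mul0r, mulr0, addr0).
Qed.

Let cVU (u : R * R -> R) : {in U, continuous u} -> {in V, continuous u}.
Proof. by move=> cu x /set_mem/VU Ux; apply: cu; exact: mem_set. Qed.

Let cg1 : continuous (g1 \_ V).
Proof.
apply: restrict_continuous => [x Vx|x /vanish]; last first.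
  by apply: filterS => y /[apply] /vanish4[].
have cix := cVU cinner Vx; have ci'x := cVU cinner' Vx.
have cp := cVU cp1 Vx; have cF := cF1 Vx; have cf := cf1 Vx.
have cx := @cXp x; have cy := @cYp x; have cx' := @cX'p x.
by apply: cvgD; [apply: cvgD; [exact: cvgM (cvgM (cvgM cx' cy) cix) cF|
  exact: cvgM (cvgM (cvgM cx cy) (cvgM ci'x cp)) cF]|
  exact: cvgM (cvgM (cvgM cx cy) cix) cf].
Qed.

Let cg2 : continuous (g2 \_ V).
Proof.
apply: restrict_continuous => [x Vx|x /vanish]; last first.
  by apply: filterS => y /[apply] /vanish4[].
have cix := cVU cinner Vx; have ci'x := cVU cinner' Vx.
have cp := cVU cp2 Vx; have cF := cF2 Vx; have cf := cf2 Vx.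
have cx := @cXp x; have cy := @cYp x; have cy' := @cY'p x.
by apply: cvgD; [apply: cvgD; [exact: cvgM (cvgM (cvgM cx cy') cix) cF|
  exact: cvgM (cvgM (cvgM cx cy) (cvgM ci'x cp)) cF]|
  exact: cvgM (cvgM (cvgM cx cy) cix) cf].
Qed.

Let dG1 (x : R * R) : is_derive x.1 1 (fun s => (G1 \_ V) (s, x.2)) ((g1 \_ V) x).
Proof.
apply: (restrict_derive (m := fun s => (s, x.2))) => [|||nVx].
- exact: continuous_pairl.
- rewrite -surjective_pairing => Vx; rewrite patchE mem_set//.
  have dX : is_derive x.1 1 X (X' x.1) by case: tX.
  have di : is_derive x.1 1 (fun s => inner (s, x.2)) (inner' x * p1 x).
    rewrite [in inner' x](surjective_pairing x).
    exact: (is_derive_inner (dpsi (VU Vx)).1).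
  have dF := dF1 Vx.
  have -> : G1 \o (fun s => (s, x.2)) =
      (fun s => X s * (Y x.2 *: (inner (s, x.2) * F1 (s, x.2)))).
    by apply/funext => s; rewrite /G1 /GRing.scale/= -!mulrA.
  apply: is_derive_eq; rewrite /GRing.scale/= -surjective_pairing /g1; ring.
- by move=> y /vanish; apply: filterS => z /[apply] /vanish4[].
- by rewrite patchE ifF//; apply/negP => /set_mem; rewrite (surjective_pairing x).
Qed.

Let dG2 (x : R * R) : is_derive x.2 1 (fun s => (G2 \_ V) (x.1, s)) ((g2 \_ V) x).
Proof.
apply: (restrict_derive (m := fun s => (x.1, s))) => [|||nVx].
- exact: continuous_pairr.
- rewrite -surjective_pairing => Vx; rewrite patchE mem_set//.
  have dY : is_derive x.2 1 Y (Y' x.2) by case: tY.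
  have di : is_derive x.2 1 (fun s => inner (x.1, s)) (inner' x * p2 x).
    rewrite [in inner' x](surjective_pairing x).
    exact: (is_derive_inner (dpsi (VU Vx)).2).
  have dF := dF2 Vx.
  have -> : G2 \o (fun s => (x.1, s)) =
      (fun s => Y s * (X x.1 *: (inner (x.1, s) * F2 (x.1, s)))).
    by apply/funext => s; rewrite /G2 /GRing.scale/=; ring.
  apply: is_derive_eq; rewrite /GRing.scale/= -surjective_pairing /g2; ring.
- by move=> y /vanish; apply: filterS => z /[apply] /vanish4[].
- by rewrite patchE ifF//; apply/negP => /set_mem; rewrite (surjective_pairing x).
Qed.

(** The product of the field by the test function X (x_1) * Y (x_2) and by [inner],
    extended by zero, is C^1 with compact support in the plane; h is its
    divergence. *)
Lemma Rintegral_inner_cutoff :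
  let h x := inner x * (X x.1 * Y x.2 * (f1 x + f2 x) + X' x.1 * Y x.2 * F1 x +
      X x.1 * Y' x.2 * F2 x) +
    X x.1 * Y x.2 * inner' x * (p1 x * F1 x + p2 x * F2 x) in
  (lambda2 R).-integrable V (EFin \o h) /\ \int[lambda2 R]_(x in V) h x = 0.
Proof.
move=> h; have mV := open_plane_measurable oV.
have hE : (fun x => (g1 \_ V) x + (g2 \_ V) x) = h \_ V.
  apply/funext => x; rewrite !patchE; case: ifPn => _; last by rewrite addr0.
  by rewrite /g1 /g2 /h; ring.
have out (x : R * R) : K < `|x.1| \/ K < `|x.2| ->
    [/\ (G1 \_ V) x = 0, (G2 \_ V) x = 0, (g1 \_ V) x = 0 & (g2 \_ V) x = 0].
  move=> /QK /XYQ xQ; rewrite !patchE; case: ifPn => // _; apply: vanish4.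
  by case: xQ => ?; [exact: Or31|exact: Or32].
have [] := Rintegral_partials_compact cg1 cg2 dG1 dG2 out.
rewrite hE => ih Ih; split; last by rewrite Rintegral_mkcond.
by apply/(integrable_mkcond _ mV); rewrite restrict_EFin.
Qed.

End InnerCutoff.

(** * The area of a thin strip along a level set *)

Section StripArea.
Context {R : realType}.
Local Notation Rm := (measurableTypeR R).
Local Notation plane := (Rm * Rm)%type.
Local Notation leb := (@lebesgue_measure R).

Lemma lebesgue_measure_diameter (S : set R) (d : R) : measurable S -> 0 <= d ->
  (forall s t, S s -> S t -> `|s - t| <= d) -> (leb S <= (2 * d)%:E)%E.
Proof.
(* The factor 2 comes from an interval centered at a point of S. *)
move=> mS d0 dS; have [[s0 Ss0]|S0] := pselect (S !=set0); last first.
  have -> : S = set0 by apply/seteqP; split=> // s Ss; apply: S0; exists s.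
  by rewrite measure0 lee_fin mulr_ge0.
have : (leb S <= leb `[(s0 - d)%R, (s0 + d)%R])%E.
  apply: le_measure; rewrite ?inE//.
  move=> s Ss; rewrite /= in_itv/= -ler_distl; exact: dS.
move/le_trans; apply; rewrite lebesgue_measure_itv/= lte_fin.
case: ifPn => _; last by rewrite lee_fin mulr_ge0.
by rewrite -EFinB lee_fin; lra.
Qed.

Lemma expanding_dist (g g' : R -> R) (c s t : R) :
  (forall w, Num.min s t <= w <= Num.max s t ->
    is_derive w 1 g (g' w) /\ c <= `|g' w|) ->
  c * `|t - s| <= `|g t - g s|.
Proof.
wlog st : s t / s <= t => [th dg|].
  have [/th|/ltW/th] := leP s t; first exact.
  by rewrite minC maxC [`|t - s|]distrC [`|g t - _|]distrC; exact.
rewrite (min_l st) (max_r st) => dg.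
have [w|w|w wst ->] := @MVT_segment R g g' s t st.
- rewrite in_itv/= => /andP[sw wt].
  have wst : s <= w <= t by rewrite !ltW.
  exact: (dg w wst).1.
- apply: continuous_in_subspaceT => {}w /set_mem; rewrite /= in_itv/= => /dg[[dw _] _].
  exact/differentiable_continuous/derivable1_diffP.
- rewrite in_itv/= in wst.
  by rewrite normrM ler_wpM2r//; exact: (dg w wst).2.
Qed.

Variables (y : R * R) (r c : R) (psi p1 p2 : R * R -> R) (S : set (R * R)).
Hypothesis r0 : 0 < r.
Hypothesis c0 : 0 < c.
Hypothesis dpsi : forall x, ball y r x -> partials psi p1 p2 x.
Hypothesis mS : measurable (S : set plane).
Hypothesis SB : S `<=` ball y r.

Let between (a b s t : R) : ball a r s -> ball a r t ->
  Num.min s t <= b <= Num.max s t -> ball a r b.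
Proof.
rewrite /ball/= => /[swap]; rewrite ge_min le_max !ltr_norml => h1 h2 /andP[].
by case: (leP s t) => st /orP[] h3 /orP[] h4; lra.
Qed.

Let area_le (m : R -> \bar R) (a d : R) : measurable_fun [set: Rm] m ->
  (forall s, (0 <= m s)%E) ->
  (forall s, ball a r s -> (m s <= (2 * d)%:E)%E) ->
  (forall s, ~ ball a r s -> m s = 0%E) ->
  (\int[leb]_s m s <= (4 * r * d)%:E)%E.
Proof.
move=> mm m0 mball mout.
have -> : (\int[leb]_s m s = \int[leb]_(s in ball a r) m s)%E.
  rewrite [RHS]integral_mkcond; apply: eq_integral => s _; rewrite patchE.
  by case: ifPn => // /negP sa; apply: mout => ?; apply: sa; exact/mem_set.
have mb : measurable (ball a r : set R) by exact: measurable_ball.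
apply: (@le_trans _ _ (\int[leb]_(s in ball a r) (2 * d)%:E)%E).
  by apply: ge0_le_integral => //; exact: measurable_funTS.
have -> : (\int[leb]_(s in ball a r) (2 * d)%:E = (2 * d)%:E * leb (ball a r))%E.
  exact: integral_cst.
have -> : leb (ball a r) = (r *+ 2)%:E by apply: lebesgue_measure_ball; exact: ltW.
rewrite -EFinM lee_fin.
by rewrite le_eqVlt; apply/orP; left; apply/eqP; ring.
Qed.

(** On the lines parallel to one axis psi is expanding by the factor c, so that
    these lines meet the strip in sets of diameter at most (b - a) / c. *)
Lemma strip_area (a b : R) :
  (forall x, ball y r x -> c <= `|p1 x|) \/ (forall x, ball y r x -> c <= `|p2 x|) ->
  (forall x, S x -> a <= psi x <= b) -> a <= b ->
  (lambda2 R S <= (4 * r * ((b - a) / c))%:E)%E.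
Proof.
move=> slope Sab ab.
have d0 : 0 <= (b - a) / c by rewrite divr_ge0 ?subr_ge0// ltW.
have dist (u v : R) : a <= u <= b -> a <= v <= b -> `|u - v| <= b - a.
  by move=> /andP[? ?] /andP[? ?]; rewrite ler_norml; lra.
case: slope => pc.
  have -> : lambda2 R S = (leb \x^ leb)%E S.
    apply: product_measure_unique => // A1 A2 mA1 mA2.
    exact: product_measure2E.
  rewrite /product_measure2; apply: (area_le (a := y.2)).
  - exact: measurable_fun_ysection.
  - by move=> s; exact: measure_ge0.
  - move=> s ys; apply: lebesgue_measure_diameter => //.
      exact: measurable_ysection.
    move=> t t'; rewrite !ysectionE /= => St St'.
    rewrite ler_pdivlMr// mulrC (@le_trans _ _ `|psi (t, s) - psi (t', s)|)//.
      apply: (@expanding_dist (fun w => psi (w, s)) (fun w => p1 (w, s))) => w wt.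
      have Bw : ball y r (w, s).
        by split => //=; apply: between wt; [exact: (SB St').1|exact: (SB St).1].
      by split; [exact: (dpsi Bw).1|exact: pc].
    by apply: dist; exact: Sab.
  - move=> s ys /=; rewrite (_ : ysection S s = set0) ?measure0//.
    by apply/seteqP; split=> // t; rewrite ysectionE /= => /SB[].
rewrite /product_measure1; apply: (area_le (a := y.1)).
- exact: measurable_fun_xsection.
- by move=> s; exact: measure_ge0.
- move=> s ys; apply: lebesgue_measure_diameter => //.
    exact: measurable_xsection.
  move=> t t'; rewrite !xsectionE /= => St St'.
  rewrite ler_pdivlMr// mulrC (@le_trans _ _ `|psi (s, t) - psi (s, t')|)//.
    apply: (@expanding_dist (fun w => psi (s, w)) (fun w => p2 (s, w))) => w wt.
    have Bw : ball y r (s, w).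
      by split => //=; apply: between wt; [exact: (SB St').2|exact: (SB St).2].
    by split; [exact: (dpsi Bw).2|exact: pc].
  by apply: dist; exact: Sab.
- move=> s ys /=; rewrite (_ : xsection S s = set0) ?measure0//.
  by apply/seteqP; split=> // t; rewrite xsectionE /= => /SB[].
Qed.

End StripArea.

(** * The divergence theorem for a field tangent to the boundary *)

Section WeakDivergence.
Context {R : realType}.
Local Notation Rm := (measurableTypeR R).
Local Notation plane := (Rm * Rm)%type.
Local Notation leb := (@lebesgue_measure R).

Variables (A : set (R * R)) (F1 F2 f1 f2 : R * R -> R).
Hypothesis oA : open A.
Hypothesis dF1 : forall x : R * R, A x -> is_derive x.1 1 (fun s => F1 (s, x.2)) (f1 x).
Hypothesis dF2 : forall x : R * R, A x -> is_derive x.2 1 (fun s => F2 (x.1, s)) (f2 x).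
Hypothesis cF1 : {in A, continuous F1}.
Hypothesis cF2 : {in A, continuous F2}.
Hypothesis cf1 : {in A, continuous f1}.
Hypothesis cf2 : {in A, continuous f2}.
Hypothesis iF1 : (lambda2 R).-integrable A (EFin \o F1).
Hypothesis iF2 : (lambda2 R).-integrable A (EFin \o F2).
Hypothesis idiv : (lambda2 R).-integrable A (EFin \o (fun x => f1 x + f2 x)).

Let mA : measurable (A : set plane). Proof. exact: open_plane_measurable. Qed.

Definition weak_integrand (X X' Y Y' : R -> R) (x : R * R) : R :=
  X x.1 * Y x.2 * (f1 x + f2 x) + X' x.1 * Y x.2 * F1 x + X x.1 * Y' x.2 * F2 x.

(** The integral over A of the divergence of the product of the field by the
    test function X (x_1) * Y (x_2). *)
Definition weak_div (X X' Y Y' : R -> R) : R :=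
  \int[lambda2 R]_(x in A) weak_integrand X X' Y Y' x.

Lemma tensor_continuous (u v : R -> R) : continuous u -> continuous v ->
  continuous (fun x : R * R => u x.1 * v x.2).
Proof.
by move=> cu cv x; apply: cvgM;
  [exact: continuous_comp_fst|exact: continuous_comp_snd].
Qed.

Lemma integrable_tensor_mul (u v : R -> R) (f : R * R -> R) (M N : R) :
  continuous u -> continuous v -> (forall s, `|u s| <= M) -> (forall s, `|v s| <= N) ->
  (lambda2 R).-integrable A (EFin \o f) ->
  (lambda2 R).-integrable A (EFin \o (fun x => u x.1 * v x.2 * f x)).
Proof.
move=> cu cv uM vN intf.
have muv : measurable_fun (A : set plane) (fun x => u x.1 * v x.2).
  apply: continuous_plane_measurable => // x _; exact: tensor_continuous.
have uvMN (x : plane) : A x -> `|u x.1 * v x.2| <= M * N.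
  by rewrite normrM => _; apply: ler_pM.
exact: (integrable_EFin_bounded_mul mA muv uvMN intf).
Qed.

Lemma integrable_weak (X X' Y Y' : R -> R) : test X X' -> test Y Y' ->
  (lambda2 R).-integrable A (EFin \o weak_integrand X X' Y Y').
Proof.
move=> tX tY; have cX := test_continuous tX; have cY := test_continuous tY.
case: tX => _ cX' [M hM]; case: tY => _ cY' [N hN].
apply: integrable_EFinD => //; first apply: integrable_EFinD => //.
all: apply: (integrable_tensor_mul (M := M) (N := N)) => // s.
all: by [have [] := hM s|have [] := hN s].
Qed.

Section LocalVanishing.
Variables (y : R * R) (r d : R) (psi p1 p2 : R * R -> R) (C eps1 : R).
Variables (X X' Y Y' : R -> R).
Let U : set (R * R) := ball y r.
Hypothesis dr : d < r.
Hypothesis dpsi : forall x, U x -> partials psi p1 p2 x.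
Hypothesis cp1 : {in U, continuous p1}.
Hypothesis cp2 : {in U, continuous p2}.
Hypothesis Apsi : forall x, U x -> (A x <-> psi x < 0).
Hypothesis C0 : 0 <= C.
Hypothesis eps10 : 0 < eps1.
Hypothesis strip : forall eps, 0 < eps < eps1 ->
  (lambda2 R [set x | (A x /\ U x) /\ (- (3 * eps) < psi x)%R] <= (C * eps)%:E)%E.
Hypothesis small : forall k, 0 < k -> exists2 eps, 0 < eps &
  forall x : R * R, `|x.1 - y.1| <= d -> `|x.2 - y.2| <= d -> A x -> - eps < psi x ->
    `|p1 x * F1 x + p2 x * F2 x| <= k.
Hypothesis tX : test X X'.
Hypothesis tY : test Y Y'.
Hypothesis Xout : forall s, d < `|s - y.1| -> X s = 0 /\ X' s = 0.
Hypothesis Yout : forall s, d < `|s - y.2| -> Y s = 0 /\ Y' s = 0.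

Let oU : open U. Proof. exact: ball_open. Qed.
Let V := A `&` U.
Let oV : open V. Proof. exact: openI. Qed.
Let mV : measurable (V : set plane). Proof. exact: open_plane_measurable. Qed.
Let Q : set (R * R) := `[y.1 - d, y.1 + d]%classic `*` `[y.2 - d, y.2 + d]%classic.

Let QE x : Q x <-> `|x.1 - y.1| <= d /\ `|x.2 - y.2| <= d.
Proof.
rewrite !ler_distl; split=> [[]|[h1 h2]]; first by rewrite /= !in_itv.
by split; rewrite /= in_itv.
Qed.

Let QU : Q `<=` U.
Proof.
move=> x /QE[x1 x2]; split; rewrite /ball/= distrC; exact: le_lt_trans dr.
Qed.

Let XYQ x : ~ Q x -> (X x.1 = 0 /\ X' x.1 = 0) \/ (Y x.2 = 0 /\ Y' x.2 = 0).
Proof.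
move=> nQ; have [/Xout|x1] := ltP d `|x.1 - y.1|; first by left.
have [/Yout|x2] := ltP d `|x.2 - y.2|; first by right.
by exfalso; apply: nQ; apply/QE.
Qed.

Let K := `|y.1| + `|y.2| + d.

Let QK (x : R * R) : K < `|x.1| \/ K < `|x.2| -> ~ Q x.
Proof.
move=> xK /QE[x1 x2].
have := ler_distD y.1 x.1 0; have := ler_distD y.2 x.2 0; rewrite !subr0.
have := normr_ge0 y.1; have := normr_ge0 y.2.
by move: xK; rewrite /K => -[]; lra.
Qed.

Let l := weak_integrand X X' Y Y'.
Let e n : R := n.+1%:R^-1.
Let en0 n : 0 < e n. Proof. by rewrite invr_gt0. Qed.
Let k n x := X x.1 * Y x.2 * inner' psi (e n) x * (p1 x * F1 x + p2 x * F2 x).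

Let cVA (u : R * R -> R) : {in A, continuous u} -> {in V, continuous u}.
Proof. by move=> cu x /set_mem[Ax _]; apply: cu; exact: mem_set. Qed.

Let ilV : (lambda2 R).-integrable V (EFin \o l).
Proof.
have AV : V `<=` A by move=> x [].
exact: (integrableS mA mV AV (integrable_weak tX tY)).
Qed.

Let ident n :
  (lambda2 R).-integrable V (EFin \o (fun x => inner psi (e n) x * l x + k n x)) /\
  \int[lambda2 R]_(x in V) (inner psi (e n) x * l x + k n x) = 0.
Proof.
apply: (Rintegral_inner_cutoff (U := U) (Q := Q) (K := K)) => //.
- by move=> x [].
- by move=> x Ux nV; rewrite leNgt; apply/negP => /(Apsi Ux) Ax; apply: nV.
- by move=> x [/dF1].
- by move=> x [/dF2].
- exact: cVA.
- exact: cVA.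
- exact: cVA.
- exact: cVA.
- apply: compact_closed; first exact: norm_hausdorff.
  by apply: compact_setX; exact: segment_compact.
Qed.

Let psicont : {in V, continuous psi}.
Proof.
have cpsi := partials_continuous oU dpsi cp1 cp2.
by move=> x /set_mem[_ Ux]; apply: cpsi; exact: mem_set.
Qed.

Let V0 x : V x -> psi x < 0. Proof. by move=> [Ax Ux]; exact/Apsi. Qed.

Let mpsi : measurable_fun (V : set plane) psi.
Proof. exact: continuous_plane_measurable. Qed.

Let minner n : measurable_fun (V : set plane) (inner psi (e n)).
Proof.
apply: measurable_funB; first exact: measurable_cst.
apply: (measurableT_comp (f := @step R)).
  apply: continuous_measurable_fun => s.
  apply/differentiable_continuous/derivable1_diffP.
  by case: (is_derive_step s).
apply: measurable_funD; last exact: measurable_cst.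
by apply: measurable_funM; last exact: measurable_cst.
Qed.

Let inner_le1 n x : `|inner psi (e n) x| <= 1.
Proof.
have /andP[s0 s1] := step_bounds (psi x / e n + 3).
by rewrite /inner ler_norml; lra.
Qed.

Let iinner n : (lambda2 R).-integrable V (EFin \o (fun x => inner psi (e n) x * l x)).
Proof.
exact: (integrable_EFin_bounded_mul mV (@minner n) (fun x _ => inner_le1 n x) ilV).
Qed.

Let cvg_inner : (\int[lambda2 R]_(x in V) (inner psi (e n) x * l x)) @[n --> \oo] -->
  \int[lambda2 R]_(x in V) l x.
Proof.
have [||||//] := @Rintegral_dominated_convergence _ _ _ (lambda2 R) V
  (fun n x => inner psi (e n) x * l x) l (fun x => `|(l x)%:E|)%E mV.
- by move=> n; have /measurable_EFinP := measurable_int _ (iinner n).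
- move=> x Vx; apply: cvg_near_cst; have psix := V0 Vx.
  near=> n; rewrite /inner step_le0 ?subr0 ?mul1r//.
  rewrite -lerBrDr sub0r ler_pdivrMr// mulNr -lerNr.
  have : e n < - psi x / 3.
    near: n; apply: (cvgr_lt _ (@cvg_harmonic R)).
    by rewrite divr_gt0// oppr_gt0.
  by lra.
- exact: integrable_abse.
- by move=> n x Vx; rewrite lee_fin normrM ler_piMl// inner_le1.
Unshelve. all: by end_near. Qed.

Let ik n : (lambda2 R).-integrable V (EFin \o k n).
Proof.
have [ih _] := ident n.
have -> : k n = (fun x => (inner psi (e n) x * l x + k n x) +
    - (inner psi (e n) x * l x)).
  by apply/funext => x; rewrite addrAC subrr add0r.
exact: (integrable_EFinD mV ih (integrable_EFinN (iinner n))).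
Qed.

Let k_small (q : R) : 0 < q ->
  \forall n \near \oo, `|\int[lambda2 R]_(x in V) k n x| <= q.
Proof.
move=> q0.
have [M hM] : exists M, forall s, `|X s| <= M.
  by case: tX => _ _ [M hM]; exists M => s; case: (hM s).
have [N hN] : exists N, forall s, `|Y s| <= N.
  by case: tY => _ _ [N hN]; exists N => s; case: (hN s).
have M0 : 0 <= M by exact: le_trans (hM 0).
have N0 : 0 <= N by exact: le_trans (hN 0).
have D0 : 0 < M * N * C + 1 by rewrite ltr_wpDl// !mulr_ge0.
pose kap := q / (M * N * C + 1).
have kap0 : 0 < kap by rewrite divr_gt0.
have [eps2 eps20 hsmall] := small kap0.
near=> n.
have en1 : e n < eps1 by near: n; apply: (cvgr_lt _ (@cvg_harmonic R)).
have en2 : e n < eps2 / 3.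
  by near: n; apply: (cvgr_lt _ (@cvg_harmonic R)); rewrite divr_gt0.
pose P := psi @^-1` `](- (3 * e n)), +oo[%classic : set plane.
have mVP : measurable (V `&` P : set plane) by apply: mpsi => //; exact: measurable_itv.
have VPE : V `&` P = [set x | (A x /\ U x) /\ (- (3 * e n) < psi x)%R].
  apply/seteqP; split=> x [Vx Px]; split => //.
    by move: Px; rewrite /P /= in_itv/= andbT.
  by rewrite /P /= in_itv/= andbT.
have area_P : (lambda2 R (V `&` P) <= (C * e n)%:E)%E.
  by rewrite VPE; apply: strip; rewrite en0.
have -> : \int[lambda2 R]_(x in V) k n x = \int[lambda2 R]_(x in V `&` P) k n x.
  rewrite [RHS]Rintegral_mkcondr; apply: eq_Rintegral => x Vx; rewrite patchE.
  case: ifPn => // /negP nP; rewrite /k /inner' hat_out ?mul0r ?oppr0 ?mulr0 ?mul0r//.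
  left; rewrite -lerBrDr sub0r ler_pdivrMr// leNgt; apply/negP => h.
  by apply: nP; apply/mem_set; rewrite /P /= in_itv/= andbT -mulNr.
pose a := M * N * (e n)^-1 * kap.
have a0 : 0 <= a by rewrite !mulr_ge0// ?invr_ge0 ltW.
have VPV : V `&` P `<=` V by move=> x [].
have ikP := integrableS mV mVP VPV (ik n).
have kle x : (V `&` P) x -> `|k n x| <= a.
  move=> [Vx Px]; have [Qx|nQ] := pselect (Q x); last first.
    by rewrite /k; have [] := XYQ nQ => -[-> _]; rewrite ?(mul0r, mulr0) normr0.
  have [x1 x2] := (QE x).1 Qx.
  have /hsmall := x1 => /(_ x2 Vx.1) hx.
  have psix : - eps2 < psi x.
    by move: Px; rewrite /P /= in_itv/= andbT; apply: le_lt_trans; lra.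
  have /andP[h0 h1] := hat_bounds (psi x / e n + 3).
  rewrite /k !normrM !ler_pM ?mulr_ge0 ?hx//.
  rewrite /inner' normrN normrM !ger0_norm ?invr_ge0 ?(ltW (en0 n))//.
  by rewrite ler_piMl ?invr_ge0 ?(ltW (en0 n)).
have VPfin : (lambda2 R (V `&` P) < +oo)%E by rewrite (le_lt_trans area_P)// ltry.
have icst : (lambda2 R).-integrable (V `&` P) (EFin \o cst a).
  apply/integrableP; split; first by apply/measurable_EFinP; exact: measurable_cst.
  under eq_integral do rewrite /= ger0_norm//.
  by rewrite integral_cst// lte_mul_pinfty// lee_fin.
apply: (le_trans (le_normr_Rintegral mVP ikP)).
apply: (@le_trans _ _ (\int[lambda2 R]_(x in V `&` P) a)).
  have iabs : (lambda2 R).-integrable (V `&` P) (EFin \o (fun x => `|k n x|)).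
    exact: (integrable_abse ikP).
  exact: (le_Rintegral mVP iabs icst kle).
rewrite Rintegral_cst//.
have fineP : fine (lambda2 R (V `&` P)) <= C * e n.
  by rewrite -lee_fin fineK// ge0_fin_numE.
apply: (le_trans (ler_wpM2l a0 fineP)).
have -> : a * (C * e n) = (M * N * C) * kap.
  by rewrite /a; field; rewrite gt_eqF.
rewrite /kap mulrA ler_pdivrMr// mulrC ler_wpM2l ?(ltW q0)//.
by rewrite lerDl.
Unshelve. all: by end_near. Qed.

(** Multiply by the cutoffs [inner psi (e n)], whose identities are exact, and let n
    tend to infinity. Their gradient lives where - 3 e n < psi < 0, a set of area
    O(e n) by [strip], and is O(1 / e n); since p1 F1 + p2 F2 tends to 0 there by
    [small], its contribution vanishes in the limit.

    The hypotheses are stated so that they also cover points off the boundary,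
    with a constant psi. *)
Lemma weak_div_local : weak_div X X' Y Y' = 0.
Proof.
have -> : weak_div X X' Y Y' = \int[lambda2 R]_(x in V) l x.
  rewrite /weak_div [LHS]Rintegral_mkcond [RHS]Rintegral_mkcond.
  apply: eq_Rintegral => x _; rewrite !patchE.
  case: ifPn => Ax; case: ifPn => Vx //.
    have nQ : ~ Q x.
      move=> /QU Ux; move/negP: Vx; apply; apply/mem_set; split => //.
      exact: set_mem.
    by rewrite /weak_integrand; have [] := XYQ nQ => -[-> ->];
      rewrite ?(mul0r, mulr0, addr0).
  by exfalso; move/negP: Ax; apply; move/set_mem: Vx => [? _]; exact: mem_set.
have zero : (\int[lambda2 R]_(x in V) (inner psi (e n) x * l x)) @[n --> \oo] --> 0.
  have -> : (fun n => \int[lambda2 R]_(x in V) (inner psi (e n) x * l x)) =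
      (fun n => - \int[lambda2 R]_(x in V) k n x).
    apply/funext => n; have [ih] := ident n.
    by rewrite RintegralD// => /eqP; rewrite addr_eq0 => /eqP.
  apply/cvgrPdist_le => q /k_small; apply: filterS => n.
  by rewrite sub0r opprK.
exact: cvg_unique cvg_inner zero.
Qed.

End LocalVanishing.

(** The local form of the divergence theorem, which [weak_div_compact] glues. *)
Definition weak_div_vanishes_near (y : R * R) (d : R) := forall X X' Y Y' : R -> R,
  test X X' -> test Y Y' ->
  (forall s, d < `|s - y.1| -> X s = 0 /\ X' s = 0) ->
  (forall s, d < `|s - y.2| -> Y s = 0 /\ Y' s = 0) ->
  weak_div X X' Y Y' = 0.

(** Take psi = - 1 near a point of A, psi = 1 near a point outside the closure. *)
Lemma weak_div_off_boundary (y : R * R) : ~ bd A y ->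
  exists2 d, 0 < d & weak_div_vanishes_near y d.
Proof.
move=> nbd.
have [r [c [r0 c10 Ac]]] : exists r c : R, [/\ 0 < r, c = -1 \/ c = 1 &
    forall x, ball y r x -> (A x <-> c < 0)].
  have [Ay|nAy] := pselect (A y).
    have /nbhs_ballP[r /= r0 rA] : nbhs y A by exact: open_nbhs_nbhs.
    by exists r, (-1); split => //; [left|move=> x /rA Ax; rewrite ltrN10].
  have ncl : ~ closure A y.
    by move=> clA; apply: nbd; split => //; rewrite (interior_id A).1.
  have : nbhs y (~` closure A).
    by apply: open_nbhs_nbhs; split => //; apply: closed_openC; exact: closed_closure.
  move=> /nbhs_ballP[r /= r0 rA]; exists r, 1; split => //; first by right.
  move=> x /rA nAx; rewrite ltNge ler01; split => // Ax.
  by exfalso; apply: nAx; exact: subset_closure.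
exists (r / 2); first by rewrite divr_gt0.
move=> X X' Y Y' tX tY Xout Yout.
apply: (@weak_div_local y r (r / 2) (cst c) (cst 0) (cst 0) 0 (1 / 4)) => //.
- by rewrite ltr_pdivrMr// mulr_natr mulr2n ltrDl.
- by move=> x _; split; exact: is_derive_cst.
- by move=> x _; exact: cvg_cst.
- by move=> x _; exact: cvg_cst.
- move=> eps /andP[e0 e1]; rewrite (_ : [set x | _] = set0) ?measure0 ?mul0r//.
  apply/seteqP; split=> // x [[Ax Bx] /=] h.
  have c0 := (Ac x Bx).1 Ax.
  by case: c10 c0 h => ->; lra.
- move=> k k0; exists 1 => // x _ _ _ _.
  by rewrite !mul0r addr0 normr0 ltW.
Qed.

Section NearBoundary.
Variables (y : R * R) (U : set (R * R)) (psi p1 p2 : R * R -> R).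
Hypothesis oU : open U.
Hypothesis Uy : U y.
Hypothesis dpsi : forall x, U x -> partials psi p1 p2 x.
Hypothesis cp1 : {in U, continuous p1}.
Hypothesis cp2 : {in U, continuous p2}.
Hypothesis slope : p1 y != 0 \/ p2 y != 0.
Hypothesis Apsi : forall x, U x -> (A x <-> psi x < 0).
Hypothesis tangent : forall z, U z -> bd A z ->
  p1 x * F1 x + p2 x * F2 x @[x --> within A (nbhs z)] --> (0 : R).

Let cpsi : {in U, continuous psi}.
Proof. exact: partials_continuous oU dpsi cp1 cp2. Qed.

(** Compactness makes the limit at the boundary uniform: points of A far from the
    boundary have psi bounded away from 0. *)
Let uniformly_tangent (Q : set (R * R)) (k : R) : compact Q -> Q `<=` U -> 0 < k ->
  exists2 eps, 0 < eps & forall x, Q x -> A x -> - eps < psi x ->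
    `|p1 x * F1 x + p2 x * F2 x| <= k.
Proof.
move=> /compact_near_coveringP cQ QU k0.
pose P (eps : R) (x : R * R) :=
  A x -> - eps < psi x -> `|p1 x * F1 x + p2 x * F2 x| <= k.
have cover : \forall eps \near 0^'+, Q `<=` P eps.
  apply: cQ => x Qx; have Ux := QU x Qx.
  have [Ax|nAx] := pselect (A x).
    have psix := (Apsi Ux).1 Ax.
    have cpx : psi @ x --> psi x by apply: cpsi; exact: mem_set.
    have n1 : \forall z \near x, psi z < psi x / 2.
      by apply: (cvgr_lt _ cpx); rewrite ltr_pdivlMr//; lra.
    have n2 : \forall eps \near 0^'+, eps < - psi x / 2.
      by apply: nbhs_right_lt; rewrite divr_gt0// oppr_gt0.
    near=> z eps => /= _ h; exfalso.
    have : psi z < psi x / 2 by near: z.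
    have : eps < - psi x / 2 by near: eps.
    by lra.
  have [clx|nclx] := pselect (closure A x).
    have bx : bd A x by split => //; rewrite (interior_id A).1.
    have n1 : \forall z \near x, A z -> `|p1 z * F1 z + p2 z * F2 z| <= k.
      have := tangent Ux bx; move/cvgr0_norm_le => /(_ _ k0); exact.
    by near=> z eps => /= Az _; move: Az; near: z.
  have n1 : nbhs x (~` closure A).
    by apply: open_nbhs_nbhs; split => //; apply: closed_openC; exact: closed_closure.
  near=> z eps => /= Az _; exfalso.
  have : (~` closure A) z by near: z.
  by apply; exact: subset_closure.
near (0 : R)^'+ => eps.
have eps0 : 0 < eps by [].
exists eps => // x Qx Ax h.
have QP : Q `<=` P eps by near: eps.
exact: QP.
Unshelve. all: by end_near. Qed.

Lemma weak_div_near_boundary : exists2 d, 0 < d & weak_div_vanishes_near y d.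
Proof.
have [r [c [r0 c0 rU rp]]] : exists r c : R, [/\ 0 < r, 0 < c, ball y r `<=` U &
    (forall x, ball y r x -> c <= `|p1 x|) \/ (forall x, ball y r x -> c <= `|p2 x|)].
  have nU : nbhs y U by exact: open_nbhs_nbhs.
  have away (p : R * R -> R) : {in U, continuous p} -> p y != 0 ->
      exists2 r : R, 0 < r & forall x, ball y r x -> U x /\ `|p y| / 2 <= `|p x|.
    move=> cp py.
    have cpy : `|p x| @[x --> y] --> `|p y|.
      by apply: cvg_norm; apply: cp; exact: mem_set.
    have n1 : \forall x \near y, `|p y| / 2 <= `|p x|.
      apply: (cvgr_ge _ cpy); rewrite ltr_pdivrMr// mulr_natr mulr2n ltrDl.
      by rewrite normr_gt0.
    have /nbhs_ballP[r /= r0 h] : nbhs y [set x | U x /\ `|p y| / 2 <= `|p x|].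
      exact: filterI.
    by exists r.
  case: slope => py.
    have [r r0 h] := away p1 cp1 py; exists r, (`|p1 y| / 2); split => //.
    - by rewrite divr_gt0// normr_gt0.
    - by move=> x /h[].
    - by left => x /h[].
  have [r r0 h] := away p2 cp2 py; exists r, (`|p2 y| / 2); split => //.
  - by rewrite divr_gt0// normr_gt0.
  - by move=> x /h[].
  - by right => x /h[].
exists (r / 2); first by rewrite divr_gt0.
move=> X X' Y Y' tX tY Xout Yout.
have oV : open (A `&` ball y r) by apply: openI => //; exact: ball_open.
have rball x : ball y r x -> U x by exact: rU.
have rin (f : R * R -> R) : {in U, continuous f} ->
    {in (ball y r : set (R * R)), continuous f}.
  by move=> cf x /set_mem/rU Ux; apply: cf; exact: mem_set.
apply: (@weak_div_local y r (r / 2) psi p1 p2 (4 * r * 3 / c) 1) => //.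
- by rewrite ltr_pdivrMr// mulr_natr mulr2n ltrDl.
- by move=> x /rU; exact: dpsi.
- exact: rin.
- exact: rin.
- by move=> x /rU; exact: Apsi.
- by rewrite divr_ge0 ?mulr_ge0 ?(ltW r0) ?(ltW c0).
- move=> eps /andP[e0 _].
  have -> : 4 * r * 3 / c * eps = 4 * r * ((0 - - (3 * eps)) / c).
    by rewrite sub0r opprK; ring.
  apply: (strip_area r0 c0 (psi := psi) (p1 := p1) (p2 := p2)) => //.
  + by move=> x /rU; exact: dpsi.
  + have -> : [set x | (A x /\ ball y r x) /\ - (3 * eps) < psi x] =
        (A `&` ball y r) `&` psi @^-1` `](- (3 * eps)), +oo[%classic.
      by apply/seteqP; split=> x [Vx /=]; rewrite in_itv/= andbT.
    apply: (continuous_plane_measurable oV) => //.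
    + by move=> x /set_mem[_ /rU Ux]; apply: cpsi; exact: mem_set.
    + exact: open_plane_measurable.
  + by move=> x [[]].
  + exact: rp.
  + move=> x [[Ax /rU Ux] /= h]; rewrite (ltW h)/=.
    by apply: ltW; exact/Apsi.
  + by rewrite oppr_le0 mulr_ge0// ltW.
- move=> k k0.
  pose Q : set (R * R) := `[y.1 - r / 2, y.1 + r / 2]%classic `*`
    `[y.2 - r / 2, y.2 + r / 2]%classic.
  have QU : Q `<=` U.
    move=> x [/=]; rewrite !in_itv/= -!ler_distl => x1 x2; apply: rU.
    have r2 : r / 2 < r by rewrite ltr_pdivrMr// mulr_natr mulr2n ltrDl.
    by split; rewrite /ball/= distrC; exact: le_lt_trans r2.
  have cQ : compact Q by apply: compact_setX; exact: segment_compact.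
  have [eps e0 h] := uniformly_tangent cQ QU k0.
  exists eps => // x x1 x2; apply: h.
  by split; rewrite /= in_itv/= -ler_distl.
Qed.

End NearBoundary.

(** Linearity in the test function. Both factors depend on the index, so that
    either of them can be split. *)
Lemma weak_div_split_sum (M : nat) (X X' Y Y' : R -> R) (Z Z' W W' : nat -> R -> R) :
  (forall i, (i < M)%N -> test (Z i) (Z' i) /\ test (W i) (W' i)) ->
  (forall x, weak_integrand X X' Y Y' x =
    \sum_(i < M) weak_integrand (Z i) (Z' i) (W i) (W' i) x) ->
  (forall i, (i < M)%N -> weak_div (Z i) (Z' i) (W i) (W' i) = 0) ->
  weak_div X X' Y Y' = 0.
Proof.
move=> tZ XZ Z0; rewrite /weak_div (_ : weak_integrand _ _ _ _ = fun x =>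
  \sum_(i < M) weak_integrand (Z i) (Z' i) (W i) (W' i) x); last exact/funext.
suff /(_ M (leqnn M))[] : forall m, (m <= M)%N ->
    (lambda2 R).-integrable A (EFin \o (fun x =>
      \sum_(i < m) weak_integrand (Z i) (Z' i) (W i) (W' i) x)) /\
    \int[lambda2 R]_(x in A)
      (\sum_(i < m) weak_integrand (Z i) (Z' i) (W i) (W' i) x) = 0.
  by [].
elim=> [_|m IH mM].
  rewrite (_ : (fun x => _) = cst 0); last first.
    by apply/funext => x; rewrite big_ord0.
  by split; [exact: integrable0|rewrite Rintegral_cst// mul0r].
have [im Im] := IH (ltnW mM); have [tz tw] := tZ m mM.
have iZ := integrable_weak tz tw.
have -> : (fun x => \sum_(i < m.+1) weak_integrand (Z i) (Z' i) (W i) (W' i) x) =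
    (fun x => \sum_(i < m) weak_integrand (Z i) (Z' i) (W i) (W' i) x +
      weak_integrand (Z m) (Z' m) (W m) (W' m) x).
  by apply/funext => x; rewrite big_ord_recr.
split; first exact: (integrable_EFinD mA im iZ).
by rewrite RintegralD// Im add0r; exact: Z0.
Qed.

(** Two knots precede - K because the B-splines sum to 1 from the third knot on. *)
Lemma partition_of_unity (K h : R) : 0 <= K -> 0 < h -> exists (M : nat) (c : R),
  (forall i, (i < M)%N -> - K - 2 * h <= c + i%:R * h <= K + h) /\
  forall X X' : R -> R, (forall s, K < `|s| -> X s = 0 /\ X' s = 0) -> forall s,
    X s = \sum_(i < M) X s * bump (c + i%:R * h) h s /\
    X' s = \sum_(i < M)
      (X' s * bump (c + i%:R * h) h s + X s * bump' (c + i%:R * h) h s).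
Proof.
move=> K0 h0; pose c := - K - 2 * h; pose M := (Num.truncn ((2 * K + 2 * h) / h)).+1.
have Mgt : (2 * K + 2 * h) / h < M%:R by exact: truncnS_gt.
have Mle : M%:R <= (2 * K + 2 * h) / h + 1.
  rewrite /M -natr1 lerD2r truncn_le; apply: divr_ge0; lra.
exists M, c; split => [i iM|X X' XK s].
  have iM' : i%:R + 1 <= M%:R :> R by rewrite natr1 ler_nat.
  have ih0 : 0 <= i%:R * h by rewrite mulr_ge0// ltW.
  have : i%:R * h <= 2 * K + 2 * h.
    by rewrite -ler_pdivlMr//; lra.
  by rewrite /c; lra.
have [sK|/XK[-> ->]] := leP `|s| K; last first.
  by split; apply/esym; apply: big1 => i _; rewrite !mul0r ?addr0.
have [S1 S0] : \sum_(i < M) bump (c + i%:R * h) h s = 1 /\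
    \sum_(i < M) bump' (c + i%:R * h) h s = 0.
  apply: sum_bump => //; move: sK; rewrite ler_norml /c => /andP[s1 s2].
  have : 2 * K + 2 * h < M%:R * h by rewrite -ltr_pdivrMr.
  by lra.
by rewrite big_split/= -!mulr_sumr S1 S0 !mulr1 mulr0 addr0.
Qed.

(** By compactness one size d of squares suits all centers in a large square; the
    test function is then split with B-splines of step d / 2, whose supports have
    half-width 3 d / 4. *)
Lemma weak_div_compact (K : R) (X X' Y Y' : R -> R) :
  (forall y, exists2 d, 0 < d & weak_div_vanishes_near y d) -> 0 <= K ->
  test X X' -> test Y Y' ->
  (forall s, K < `|s| -> X s = 0 /\ X' s = 0) ->
  (forall s, K < `|s| -> Y s = 0 /\ Y' s = 0) ->
  weak_div X X' Y Y' = 0.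
Proof.
move=> loc K0 tX tY XK YK.
(* The margin 3 leaves room for the centers of the outermost B-splines. *)
pose Q : set (R * R) := `[- (K + 3), K + 3]%classic `*` `[- (K + 3), K + 3]%classic.
have [d d0 [d1 Qd]] : exists2 d : R, 0 < d &
    d < 1 /\ forall y, Q y -> weak_div_vanishes_near y d.
  have cover : \forall d \near 0^'+, Q `<=` weak_div_vanishes_near ^~ d.
    have /compact_near_coveringP cQ : compact Q.
      by apply: compact_setX; exact: segment_compact.
    apply: (cQ _ _ (fun d y => weak_div_vanishes_near y d)) => y _.
    have [d d0 yd] := loc y.
    have d20 : 0 < d / 2 by rewrite divr_gt0.
    have n1 : \forall z \near y, ball y (d / 2) z by exact: (nbhsx_ballx y _ d20).
    have n2 : \forall q \near 0^'+, q < d / 2 by exact: nbhs_right_lt.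
    near=> z q => /= X1 X1' Y1 Y1' t1 t2 out1 out2; apply: yd => //.
      move=> s ds; apply: out1.
      have /= zy : ball y.1 (d / 2) z.1 by have [] : ball y (d / 2) z by near: z.
      have qd : q < d / 2 by near: q.
      have := ler_distD z.1 s y.1; rewrite (distrC z.1).
      by move: zy; rewrite /ball/=; lra.
    move=> s ds; apply: out2.
    have /= zy : ball y.2 (d / 2) z.2 by have [] : ball y (d / 2) z by near: z.
    have qd : q < d / 2 by near: q.
    have := ler_distD z.2 s y.2; rewrite (distrC z.2).
    by move: zy; rewrite /ball/=; lra.
  near (0 : R)^'+ => d; exists d => //; split; first by near: d; exact: nbhs_right_lt.
  have Qd : Q `<=` weak_div_vanishes_near ^~ d by near: d.
  exact: Qd.
pose h := d / 2.
have h0 : 0 < h by rewrite divr_gt0.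
have [M [c [cM pu]]] := partition_of_unity K0 h0.
pose b i := bump (c + i%:R * h) h.
pose b' i := bump' (c + i%:R * h) h.
pose ctr i := c + i%:R * h + 3 / 2 * h.
have tb i : test (b i) (b' i) by exact: test_bump.
have bout i s : d < `|s - ctr i| -> b i s = 0 /\ b' i s = 0.
  move=> ds; apply: bump_out => //; apply/negP => /andP[s1 s2].
  by move: ds; rewrite ltNge ler_norml /ctr /h; move: s1 s2; rewrite /h; lra.
have ctrQ i : (i < M)%N -> - (K + 3) <= ctr i <= K + 3.
  by move=> /cM; rewrite /ctr /h; lra.
apply: (@weak_div_split_sum M _ _ _ _ (fun i s => X s * b i s)
  (fun i s => X' s * b i s + X s * b' i s) (fun _ => Y) (fun _ => Y')).
- by move=> i _; split => //; exact: test_mul.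
- move=> x; have [e1 e2] := pu X X' XK x.1.
  rewrite {1}/weak_integrand {1 2}e1 e2 !mulr_suml -!big_split/=.
  by apply: eq_bigr => i _.
move=> i iM.
have tXb : test (fun s => X s * b i s) (fun s => X' s * b i s + X s * b' i s).
  exact: test_mul.
apply: (@weak_div_split_sum M _ _ _ _ (fun _ s => X s * b i s)
  (fun _ s => X' s * b i s + X s * b' i s) (fun j s => Y s * b j s)
  (fun j s => Y' s * b j s + Y s * b' j s)).
- by move=> j _; split => //; exact: test_mul.
- move=> x; have [e1 e2] := pu Y Y' YK x.2.
  rewrite {1}/weak_integrand {1 2}e1 e2 !mulr_sumr !mulr_suml -!big_split/=.
  by apply: eq_bigr => j _.
move=> j jM; apply: (Qd (ctr i, ctr j)).
- by split; rewrite /= in_itv/=; exact: ctrQ.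
- exact: tXb.
- exact: test_mul.
- by move=> s /bout[-> ->]; rewrite !mulr0 addr0.
- by move=> s /bout[-> ->]; rewrite !mulr0 addr0.
Unshelve. all: by end_near. Qed.

(** The cutoffs have uniformly bounded gradients, supported ever farther away, so
    that integrability of the field itself kills their contribution. *)
Theorem Rintegral_divergence_local0 :
  (forall y, exists2 d, 0 < d & weak_div_vanishes_near y d) ->
  \int[lambda2 R]_(x in A) (f1 x + f2 x) = 0.
Proof.
move=> loc.
have zero n : weak_div (cutoff n) (cutoff' n) (cutoff n) (cutoff' n) = 0.
  have tc := @test_cutoff R n.
  have out (s : R) : n%:R + 2 < `|s| -> cutoff n s = 0 /\ cutoff' n s = 0.
    by move=> /ltW; exact: cutoff_out.
  have n2 : 0 <= n%:R + 2 :> R by rewrite addr_ge0.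
  exact: (weak_div_compact loc n2 tc tc out out).
pose l n := weak_integrand (cutoff n) (cutoff' n) (cutoff n) (cutoff' n).
pose G x := `|f1 x + f2 x| + `|F1 x| + `|F2 x|.
have iG : (lambda2 R).-integrable A (EFin \o G).
  have i1 := integrable_abse idiv; have i2 := integrable_abse iF1.
  have i3 := integrable_abse iF2.
  exact: (integrable_EFinD mA (integrable_EFinD mA i1 i2) i3).
have ml n : measurable_fun (A : set plane) (l n).
  have tc := @test_cutoff R n.
  by have /measurable_EFinP := measurable_int _ (integrable_weak tc tc).
have cl x : A x -> l n x @[n --> \oo] --> f1 x + f2 x.
  move=> _; apply: cvg_near_cst; near=> n.
  have [c1 c1'] : cutoff n x.1 = 1 /\ cutoff' n x.1 = 0.
    by apply: cutoff_in; near: n; exact: nbhs_infty_ger.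
  have [c2 c2'] : cutoff n x.2 = 1 /\ cutoff' n x.2 = 0.
    by apply: cutoff_in; near: n; exact: nbhs_infty_ger.
  by rewrite /l /weak_integrand c1 c1' c2 c2' !(mul1r, mulr0, mul0r, addr0).
have lG n x : A x -> (`|(l n x)%:E| <= (EFin \o G) x)%E.
  move=> _; rewrite lee_fin /l /weak_integrand /G.
  have [b1 b1'] := cutoff_bounds n x.1; have [b2 b2'] := cutoff_bounds n x.2.
  rewrite (le_trans (ler_normD _ _))// lerD//; last first.
    by rewrite !normrM -[leRHS]mul1r ler_wpM2r// mulr_ile1.
  rewrite (le_trans (ler_normD _ _))// lerD//.
    by rewrite 2!normrM -[leRHS]mul1r ler_wpM2r// mulr_ile1.
  by rewrite !normrM -[leRHS]mul1r ler_wpM2r// mulr_ile1.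
have [_ cvgl] := Rintegral_dominated_convergence mA ml cl iG lG.
have : (fun n => \int[lambda2 R]_(x in A) l n x) @ \oo --> (0 : R).
  by rewrite (_ : (fun n => _) = cst 0); [exact: cvg_cst|apply/funext].
exact: cvg_unique cvgl.
Unshelve. all: by end_near. Qed.

(** The boundary of A is given near each of its points by a C^1 function psi with
    A = {psi < 0}; that F . grad psi tends to 0 says that the normal component of
    the field (F1, F2) vanishes at the boundary. *)
Theorem Rintegral_divergence_tangent0 :
  (forall y, bd A y -> exists (U : set (R * R)) (psi p1 p2 : R * R -> R),
    [/\ open U, U y, forall x, U x -> partials psi p1 p2 x,
        {in U, continuous p1} & {in U, continuous p2}] /\
    [/\ p1 y != 0 \/ p2 y != 0, forall x, U x -> (A x <-> psi x < 0) &
        forall z, U z -> bd A z ->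
          p1 x * F1 x + p2 x * F2 x @[x --> within A (nbhs z)] --> (0 : R)]) ->
  \int[lambda2 R]_(x in A) (f1 x + f2 x) = 0.
Proof.
move=> flat; apply: Rintegral_divergence_local0 => y.
have [/flat|] := pselect (bd A y); last exact: weak_div_off_boundary.
move=> [U [psi [p1 [p2 [[oU Uy dpsi cp1 cp2] [slope Apsi tangent]]]]]].
exact: (weak_div_near_boundary oU Uy dpsi cp1 cp2 slope Apsi tangent).
Qed.

End WeakDivergence.

(** * Bands cut by a graph *)

Section CutBands.
Context {R : realType}.
Local Notation Rm := (measurableTypeR R).
Local Notation plane := (Rm * Rm)%type.
Local Notation space := (plane * Rm)%type.

(** Continuity within S along a map that stays in S: for freezing some of the
    variables of a function of (t, x, z). *)
Lemma continuous_within_curve (X Y : topologicalType) (S : set X) (f : X -> R)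
    (m : Y -> X) (s : Y) : {within S, continuous f} -> {for s, continuous m} ->
  (\forall t \near s, S (m t)) -> f (m t) @[t --> s] --> f (m s).
Proof.
move=> /subspace_continuousP cf cm Sm W fW.
have Sms : S (m s) by exact: nbhs_singleton Sm.
have := cm _ (cf (m s) Sms W fW) => /= Wm.
have : \forall t \near s, S (m t) /\ (S (m t) -> W (f (m t))) by exact: filterI.
by apply: filterS => t [St]; exact.
Qed.

Variables (A : set (R * R)) (a b c : R * R -> R).
Hypothesis oA : open A.
Hypothesis ca : {in A, continuous a}.
Hypothesis cb : {in A, continuous b}.
Hypothesis cc : {in A, continuous c}.
Hypothesis ac : forall x, A x -> a x <= c x.
Hypothesis cb' : forall x, A x -> c x <= b x.

Let mab : measurable (band A a b : set space). Proof. exact: band_measurable. Qed.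
Let mac : measurable (band A a c : set space). Proof. exact: band_measurable. Qed.
Let mcb : measurable (band A c b : set space). Proof. exact: band_measurable. Qed.

Lemma sub_band_low : band A a c `<=` band A a b.
Proof.
move=> [x z] [/= Ax /andP[az zc]]; split => //=; rewrite az/=.
by rewrite (lt_le_trans zc)// cb'.
Qed.

Lemma sub_band_high : band A c b `<=` band A a b.
Proof.
move=> [x z] [/= Ax /andP[cz zb]]; split => //=; rewrite zb andbT.
by rewrite (le_lt_trans _ cz)// ac.
Qed.

(* The graph of c: its vertical fibers are points. *)
Let N : set space := band A a b `\` (band A c b `|` band A a c).

Let mN : measurable N.
Proof. by apply: measurableD => //; exact: measurableU. Qed.

Let N0 : lambda3 R N = 0%E.
Proof.
have -> : lambda3 R N =
    (\int[lambda2 R]_x (@lebesgue_measure R (xsection N x)))%E by [].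
apply: integral0_eq => x _.
have mx := measurable_xsection x mN.
apply/eqP; rewrite eq_le measure_ge0 andbT.
have <- : @lebesgue_measure R [set c x] = 0%E by exact: lebesgue_measure_set1.
apply: le_measure; rewrite ?inE//.
move=> z; rewrite xsectionE /= => -[[Ax /= /andP[az zb]] nU].
apply/eqP; rewrite eq_le !leNgt; apply/andP; split; apply/negP => h; apply: nU.
  by left; split => //=; rewrite h.
by right; split => //=; rewrite az.
Qed.

Let DN : band A a b `\` N = band A c b `|` band A a c.
Proof.
apply/seteqP; split=> p.
  by move=> [pab nN]; apply: contrapT => h; apply: nN.
move=> h; split; last by move=> [_].
by case: h => [/sub_band_high|/sub_band_low].
Qed.

Lemma disjoint_bands : [disjoint band A c b & band A a c].
Proof.
apply/disj_setPS => -[x z] [[_ /= /andP[cz _]] [_ /= /andP[_ zc]]].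
by move: (lt_trans cz zc); rewrite ltxx.
Qed.

Lemma Rintegral_bandU (f : (R * R) * R -> R) :
  (lambda3 R).-integrable (band A a b) (EFin \o f) ->
  \int[lambda3 R]_(p in band A c b `|` band A a c) f p =
    \int[lambda3 R]_(p in band A a b) f p.
Proof.
move=> intf; rewrite /Rintegral (negligible_integral mN mab intf N0).
by rewrite DN.
Qed.

Lemma integrable_cut_band (f : (R * R) * R -> R) :
  measurable_fun (band A a b : set space) f ->
  (lambda3 R).-integrable (band A c b) (EFin \o f) ->
  (lambda3 R).-integrable (band A a c) (EFin \o f) ->
  (lambda3 R).-integrable (band A a b) (EFin \o f) /\
  \int[lambda3 R]_(p in band A a b) f p = \int[lambda3 R]_(p in band A c b) f p +
    \int[lambda3 R]_(p in band A a c) f p.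
Proof.
move=> mf i1 i2.
have iU : (lambda3 R).-integrable (band A c b `|` band A a c) (EFin \o f).
  apply/(integrable_mkcond _ (measurableU _ _ mcb mac)).
  have -> : (EFin \o f) \_ (band A c b `|` band A a c) =
      (((EFin \o f) \_ (band A c b)) \+ ((EFin \o f) \_ (band A a c)))%E.
    apply/funext => p; rewrite !patchE in_setU.
    have [pc|pc] := boolP (p \in band A c b); have [pa|pa] := boolP (p \in band A a c);
      rewrite ?adde0 ?add0e//=.
    by move/disj_setPS: disjoint_bands => /(_ p (conj (set_mem pc) (set_mem pa))).
  have j1 := (integrable_mkcond _ mcb).1 i1; have j2 := (integrable_mkcond _ mac).1 i2.
  exact: (integrableD measurableT j1 j2).
have iab : (lambda3 R).-integrable (band A a b) (EFin \o f).
  apply/(negligible_integrable mN mab _ N0); first exact/measurable_EFinP.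
  by rewrite DN.
split=> //; rewrite -Rintegral_bandU// Rintegral_setU//; exact: disjoint_bands.
Qed.

End CutBands.

(** * The coupled model *)

Section CoupledModel.
Context {R : realType}.
Local Notation Rm := (measurableTypeR R).
Local Notation plane := (Rm * Rm)%type.
Local Notation space := (plane * Rm)%type.

Variables (D : data R) (sol : unknowns R).
Hypothesis hD : data_ok D.
Hypothesis hsol : solution D sol.
Hypothesis hreg : sufficiently_regular D sol.

Let A := Omega_x D.
Let T := T_end D.
Let sat_P (t : R) (x : R * R) (z : R) : R := sat D (P_ sol t x z).

Let oA : open A. Proof. by case: hD => -[]. Qed.
Let mA : measurable (A : set plane). Proof. exact: open_plane_measurable. Qed.

Section NoFlow.
Variables (t : R) (ht : 0 < t < T).

Let F (i : 'I_3) (x : R * R) : R := flux D sol t x i 0.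

Let rflux : regular_flux D sol. Proof. by case: hreg. Qed.

Let C1F i : C1_on A (F i).
Proof. by have [_ _ h _ _] := rflux ht; have [] := h i. Qed.

Let cvgF i y : bd A y -> cvg (F i x @[x --> within A (nbhs y)]).
Proof. by have [_ _ h _ _] := rflux ht; have [_] := h i; exact. Qed.

Let iF i : (lambda2 R).-integrable A (EFin \o F i).
Proof. by have [_ _ _ h _] := rflux ht; exact: h. Qed.

Let dotE (u v : 'cV[R]_3) : dot u v =
  u 0 0 * v 0 0 + u 1 0 * v 1 0 + u ord_max 0 * v ord_max 0.
Proof.
rewrite /dot mxE !big_ord_recr big_ord0 /= add0r !mxE.
by congr (_ * _ + _ * _ + _ * _); congr (_ _ _); apply/val_inj.
Qed.

Let dot_grad (u : 'cV[R]_3) (k : R) psi (z : R * R) :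
  dot u (k *: grad_x psi z) = k * (partial1 psi z * u 0 0 + partial2 psi z * u 1 0).
Proof. by rewrite dotE !mxE /= !mulr0 addr0; ring. Qed.

Let enorm_grad psi (z : R * R) : grad_x psi z != 0 ->
  0 < enorm (grad_x psi z) /\ (partial1 psi z != 0 \/ partial2 psi z != 0).
Proof.
move=> g0.
have slope : partial1 psi z != 0 \/ partial2 psi z != 0.
  apply: contrapT => /not_orP[/negP + /negP]; rewrite !negbK => /eqP p1 /eqP p2.
  move/eqP: g0; apply; apply/colP => i; rewrite !mxE p1 p2.
  by case: i => -[|[|[]]].
split=> //; rewrite sqrtr_gt0 dotE !mxE /= mulr0 addr0.
by case: slope => p0; [apply: ltr_pwDl|apply: ltr_wpDl];
  rewrite -?expr2 ?sqr_ge0// exprn_even_gt0.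
Qed.

(** The normal is a multiple of grad psi, so the no-flux condition says that
    F . grad psi, computed with the normal frozen at z, tends to 0. As F has a limit
    at z and grad psi is continuous, it may be computed at the moving point. *)
Lemma Rintegral_div_flux : \int[lambda2 R]_(x in A) div_x (flux D sol t) x = 0.
Proof.
have pF i x : A x -> partials (F i) (partial1 (F i)) (partial2 (F i)) x.
  exact: C1_on_partials.
have cF i : {in A, continuous (F i)}.
  by apply: (partials_continuous oA (pF i)); case: (C1F i) => _ [].
have dF0 x : A x -> is_derive x.1 1 (fun s => F 0 (s, x.2)) (partial1 (F 0) x).
  by move=> /(pF 0)[].
have dF1 x : A x -> is_derive x.2 1 (fun s => F 1 (x.1, s)) (partial2 (F 1) x).
  by move=> /(pF 1)[].
have cf0 : {in A, continuous (partial1 (F 0))} by case: (C1F 0) => _ [].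
have cf1 : {in A, continuous (partial2 (F 1))} by case: (C1F 1) => _ [].
have idiv : (lambda2 R).-integrable A
    (EFin \o (fun x => partial1 (F 0) x + partial2 (F 1) x)).
  by have [] := rflux ht.
apply: (Rintegral_divergence_tangent0 oA dF0 dF1 (cF 0) (cF 1) cf0 cf1
  (iF 0) (iF 1) idiv).
have nbd : outward_normal A (normal D) by case: hD => -[].
move=> y /nbd[U [psi [oU Uy C1psi gpsi [Apsi npsi]]]].
have [_ [cp1 cp2]] := C1psi.
exists U, psi, (partial1 psi), (partial2 psi); split.
  by split => //; exact: C1_on_partials.
split => //; first exact: (enorm_grad (gpsi y Uy)).2.
move=> z Uz bz.
have PF : ProperFilter (within A (nbhs z)) by apply: within_nbhs_proper; case: bz.
have [k0 _] := enorm_grad (gpsi z Uz).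
set k := (enorm (grad_x psi z))^-1.
have kN0 : k != 0 by rewrite invr_eq0 gt_eqF.
have /cvg_ex[l1 cl1] := @cvgF 0 z bz; have /cvg_ex[l2 cl2] := @cvgF 1 z bz.
have noflow : k * (partial1 psi z * F 0 x + partial2 psi z * F 1 x)
    @[x --> within A (nbhs z)] --> (0 : R).
  have [_ /(_ t z ht bz) + _] : eq3 D sol by case: hsol.
  by rewrite (npsi z Uz bz); under eq_fun do rewrite dot_grad.
have lim0 : partial1 psi z * l1 + partial2 psi z * l2 = 0.
  have : k * (partial1 psi z * F 0 x + partial2 psi z * F 1 x)
      @[x --> within A (nbhs z)] --> k * (partial1 psi z * l1 + partial2 psi z * l2).
    apply: cvgM; first exact: cvg_cst.
    by apply: cvgD; apply: cvgM => //; exact: cvg_cst.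
  move=> h; have /esym/eqP : 0 = k * (partial1 psi z * l1 + partial2 psi z * l2).
    exact: cvg_unique noflow h.
  by rewrite mulf_eq0 (negbTE kN0) => /eqP.
rewrite -lim0; apply: cvgD; apply: cvgM => //.
- by apply: cvg_within_filter; apply: cp1; exact: mem_set.
- by apply: cvg_within_filter; apply: cp2; exact: mem_set.
Qed.

End NoFlow.
Let h := h_ sol.
Let hb := h_bot D.
Let hs := h_soil D.

Let rho0 : 0 < rho D. Proof. by case: hD => _ []. Qed.
Let grav0 : 0 < grav D. Proof. by case: hD => _ []. Qed.
Let satP p : sat D p = 1 <-> P_s D <= p.
Proof. by case: hD => _ [_ _ _ + _] _ _ _; exact. Qed.
Let hb_lt_hs x : A x -> hb x < hs x.
Proof. by case: hD => -[_ _ _ + _] _ _ _ _; exact. Qed.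

Let chb : {in A, continuous hb}.
Proof.
have [[chb _ _] _ _ _ _] := hreg.
move=> x /set_mem Ax; apply: (continuous_within_curve (m := id) chb).
  exact: cvg_id.
exact: open_nbhs_nbhs.
Qed.

Let chs : {in A, continuous hs}.
Proof.
have [[_ chs _] _ _ _ _] := hreg.
move=> x /set_mem Ax; apply: (continuous_within_curve (m := id) chs).
  exact: cvg_id.
exact: open_nbhs_nbhs.
Qed.

Let mphi : measurable_fun (Omega D : set space) (fun p => phi D p.1 p.2).
Proof. by have [[_ _ ?] _ _ _ _] := hreg. Qed.

Let ch t : 0 <= t < T -> {in A, continuous (h t)}.
Proof.
move=> tT x /set_mem Ax; have [_ _ _ _ [_ chh]] := hreg.
apply: (continuous_within_curve (m := fun x => (t, x)) chh).
  by apply: (@cvg_pair _ _ _ (nbhs x) (nbhs t) (nbhs x));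
    [exact: cvg_cst|exact: cvg_id].
have : \forall y \near x, A y by exact: open_nbhs_nbhs.
by apply: filterS => y Ay; split.
Qed.

Let ch_time x t : A x -> 0 < t < T -> {for t, continuous (h ^~ x)}.
Proof.
move=> Ax /andP[t0 tT]; have [_ _ _ _ [_ chh]] := hreg.
apply: (continuous_within_curve (m := fun s => (s, x)) chh).
  by apply: (@cvg_pair _ _ _ (nbhs t) (nbhs t) (nbhs x));
    [exact: cvg_id|exact: cvg_cst].
near=> s; split => //=; apply/andP; split.
  by apply/ltW; near: s; exact: lt_nbhsr.
by near: s; exact: lt_nbhsl.
Unshelve. all: by end_near. Qed.

Let h_range t x : 0 <= t < T -> A x -> hb x <= h t x < hs x.
Proof.
move=> tT Ax; have [_ _ _ /(_ t x tT Ax)/andP[-> hmax] _] := hsol.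
apply: (le_lt_trans hmax); rewrite gt_max gt_min hb_lt_hs// andbT.
apply/orP; right; rewrite /h_max ltrBlDr ltrDl.
by case: hD => -[].
Qed.

(* As z > h_bot, the bound on h at this x is H - P_s / (rho g); on the graph
   itself the pressure is hydrostatic by the coupling condition. *)
Let saturated t x z : 0 < t < T -> A x -> hb x < z -> z <= h t x -> z < hs x ->
  sat_P t x z = 1.
Proof.
move=> tT Ax bz zh zs; have [t0 tT'] := andP tT.
have tT0 : 0 <= t < T by rewrite (ltW t0).
apply/satP.
have PE : P_ sol t x z = rho D * grav D * (Ht_ sol t x - z).
  have [[_ _ P1 _] P2 _ _ _] := hsol.
  move: zh; rewrite le_eqVlt => /predU1P[->|zh]; first exact: P1.
  by apply: P2 => //; split => //; split => //=; rewrite bz.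
have [_ _ _ /(_ t x tT0 Ax)/andP[_ hle] _] := hsol.
have hH : h t x <= Ht_ sol t x - P_s D / (rho D * grav D).
  move: hle; rewrite le_max le_min => /orP[/andP[]//|hb'].
  by move: (lt_le_trans bz (le_trans zh hb')); rewrite ltxx.
rewrite PE mulrC -ler_pdivrMr ?mulr_gt0//.
have := le_trans zh hH; lra.
Qed.

Let Omega_plusE t : 0 <= t < T -> Omega_plus D sol t = band A (h t) hs.
Proof.
move=> tT; apply/seteqP.
split=> [[x z] [[/= Ax /andP[_ zs]] hz]|[x z] [/= Ax /andP[hz zs]]].
  by split => //=; rewrite hz.
have /andP[bh _] := h_range tT Ax.
by split => //; split => //=; rewrite (le_lt_trans bh).
Qed.

Let Omega_minusE t : 0 <= t < T -> Omega_minus D sol t = band A hb (h t).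
Proof.
move=> tT; apply/seteqP.
split=> [[x z] [[/= Ax /andP[bz _]] zh]|[x z] [/= Ax /andP[bz zh]]].
  by split => //=; rewrite bz.
have /andP[_ hlt] := h_range tT Ax.
by split => //; split => //=; rewrite bz (lt_trans zh).
Qed.

Let water (t : R) (p : (R * R) * R) : R := phi D p.1 p.2 * sat_P t p.1 p.2.

(* The indicator of the saturated zone is absorbed into s(P). *)
Let water_mass t : 0 < t < T ->
  (lambda3 R).-integrable (band A hb hs) (EFin \o water t) /\
  M_tot D sol t = rho D * \int[lambda3 R]_(p in band A hb hs) water t p.
Proof.
move=> tT; have [t0 tT'] := andP tT.
have tT0 : 0 <= t < T by rewrite (ltW t0).
have [_ [_ /(_ t tT)[ip im]] _ _ _] := hreg.
rewrite (Omega_plusE tT0) in ip; rewrite (Omega_minusE tT0) in im.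
have bh x : A x -> hb x <= h t x by move=> Ax; have /andP[] := h_range tT0 Ax.
have hlt x : A x -> h t x <= hs x.
  by move=> Ax; have /andP[_ /ltW] := h_range tT0 Ax.
have mplus := band_measurable oA (ch tT0) chs.
have mminus := band_measurable oA chb (ch tT0).
have mOmega := band_measurable oA chb chs.
have waterE p : (band A hb hs `\` band A (h t) hs) p -> phi D p.1 p.2 = water t p.
  move=> [[Ap /andP[bp ps]] np]; rewrite /water saturated ?mulr1//.
  by rewrite leNgt; apply/negP => hp; apply: np; split => //; rewrite hp.
have mw : measurable_fun (band A hb hs : set space) (water t).
  have -> : band A hb hs = band A (h t) hs `|` (band A hb hs `\` band A (h t) hs).
    by rewrite setDUK//; exact: sub_band_high.
  apply/measurable_funU => //; first exact: measurableD.
  split; first by have /measurable_EFinP := measurable_int _ ip.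
  apply: (eq_measurable_fun (fun p => phi D p.1 p.2)).
    by move=> p /set_mem; exact: waterE.
  exact: measurable_funS mphi.
have minus_sub : band A hb (h t) `<=` band A hb hs `\` band A (h t) hs.
  move=> p pm; split; first exact: (sub_band_low hlt pm).
  move=> [_ /andP[hp _]]; have [_ /andP[_ ph]] := pm.
  by move: (lt_trans hp ph); rewrite ltxx.
have im' : (lambda3 R).-integrable (band A hb (h t)) (EFin \o water t).
  apply: eq_integrable im => // p /set_mem /minus_sub /waterE pE.
  by rewrite /= pE.
have [iw Iw] := integrable_cut_band oA chb chs (ch tT0) bh hlt mw ip im'.
split=> //; rewrite Iw /M_tot mulrDr; congr (_ * _ + _ * _).
  exact: (Rintegral_fubini_band oA (ch tT0) chs ip).
rewrite (Rintegral_fubini_band oA chb (ch tT0) im).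
by apply: eq_Rintegral => p /set_mem /minus_sub /waterE.
Qed.

Let csat x z t : Omega D (x, z) -> 0 < t < T ->
  {for t, continuous (fun s => sat_P s x z)}.
Proof.
move=> Oxz /andP[t0 tT]; have [_ [[_ cs _ _] _] _ _ _] := hreg.
apply: (continuous_within_curve (m := fun s => (s, (x, z))) cs).
  by apply: (@cvg_pair _ _ _ (nbhs t) (nbhs t) (nbhs (x, z)));
    [exact: cvg_id|exact: cvg_cst].
near=> s; split => //=; apply/andP; split; near: s; [exact: lt_nbhsr|exact: lt_nbhsl].
Unshelve. all: by end_near. Qed.

Section TimeDerivative.
Variables (t : R) (ht : 0 < t < T).

Let t0 : 0 < t. Proof. by case/andP: ht. Qed.
Let tT : t < T. Proof. by case/andP: ht. Qed.
Let ht0 : 0 <= t < T. Proof. by rewrite tT ltW. Qed.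

Let bh x : A x -> hb x <= h t x.
Proof. by move=> Ax; have /andP[] := h_range ht0 Ax. Qed.

Let hlt x : A x -> h t x < hs x.
Proof. by move=> Ax; have /andP[] := h_range ht0 Ax. Qed.

Let hle x : A x -> h t x <= hs x. Proof. by move=> /hlt/ltW. Qed.

Let plus : set space := band A (h t) hs.
Let minus : set space := band A hb (h t).
Let mplus : measurable plus. Proof. exact: (band_measurable oA (ch ht0) chs). Qed.
Let mminus : measurable minus. Proof. exact: (band_measurable oA chb (ch ht0)). Qed.
Let mW : measurable (plus `|` minus). Proof. exact: measurableU. Qed.

Let subW : plus `|` minus `<=` band A hb hs.
Proof.
by move=> p [|]; [exact: (sub_band_high bh)|exact: (sub_band_low hle)].
Qed.

Let rate (p : (R * R) * R) : R := phi D p.1 p.2 * dt_sat D sol t p.1 p.2.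

Let is_derive_saturated p : minus p ->
  is_derive t 1 (fun s => sat_P s p.1 p.2) (0 : R).
Proof.
move=> pm; have [Ap /andP[bz zh]] := pm.
have Op := subW (or_intror pm).
have n1 : \forall s \near t, 1 = sat_P s p.1 p.2.
  have nh : \forall s \near t, p.2 < h s p.1.
    by have := ch_time Ap ht; move/cvgr_gt; apply.
  near=> s; apply/esym; apply: saturated => //.
  - by apply/andP; split; near: s; [exact: lt_nbhsr|exact: lt_nbhsl].
  - by apply/ltW; near: s.
  - by case: Op => _ /andP[].
exact: near_eq_is_derive n1 (is_derive_cst (1 : R) t 1).
Unshelve. all: by end_near. Qed.

Let dt_sat_minus p : minus p -> dt_sat D sol t p.1 p.2 = 0.
Proof.
move=> /is_derive_saturated d1.
by rewrite /dt_sat derive1E (@derive_val _ _ _ _ _ _ _ d1).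
Qed.

Let is_derive_water p : (plus `|` minus) p -> is_derive t 1 (water ^~ p) (rate p).
Proof.
move=> Wp; have Op := subW Wp.
suff : is_derive t 1 (fun s => sat_P s p.1 p.2) (dt_sat D sol t p.1 p.2).
  by move=> ds; rewrite /water /rate; apply: is_derive_eq.
case: Wp => [pp|pm]; last by rewrite dt_sat_minus//; exact: is_derive_saturated.
have [_ [[_ _ dP _] _] _ _ _] := hreg.
have [_ ds] : derivable (P_ sol t p.1) p.2 1 /\
    derivable (fun tau => sat D (P_ sol tau p.1 p.2)) t 1.
  by apply: dP => //; rewrite (Omega_plusE ht0); case: (p) pp.
by rewrite /dt_sat derive1E; exact/derivableP.
Qed.

(* The set plus `|` minus is Omega without the graph of h(t): the points where
   the integrand may fail to be differentiable at time t are left out. *)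
Let leibniz : (lambda3 R).-integrable (plus `|` minus) (EFin \o rate) /\
  is_derive t 1 (fun s => \int[lambda3 R]_(p in plus `|` minus) water s p)
    (\int[lambda3 R]_(p in plus `|` minus) rate p).
Proof.
have [_ [[_ _ dP /(_ t ht)[eps0 [G [eps00 iG dom]]]] _] _ _ _] := hreg.
pose eps := Num.min eps0 (Num.min t (T - t)).
have epos : 0 < eps by rewrite /eps !lt_min eps00 t0 subr_gt0 tT.
have near_t s : `|s - t| < eps -> 0 < s < T /\ `|s - t| < eps0.
  rewrite /eps !lt_min => /and3P[h1 h2 h3]; split=> //.
  by move: h2 h3; rewrite !ltr_norml; lra.
have mOmega := band_measurable oA chb chs.
have iwater s : `|s - t| < eps ->
    (lambda3 R).-integrable (plus `|` minus) (EFin \o water s).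
  move=> /near_t[sT _]; have [iw _] := water_mass sT.
  exact: (integrableS mOmega mW subW iw).
have iG' : (lambda3 R).-integrable (plus `|` minus) (EFin \o (fun p => `|G p|)).
  by have iG' := integrableS mOmega mW subW iG; exact: (integrable_abse iG').
suff lipW s p : `|s - t| < eps -> (plus `|` minus) p ->
    `|water s p - water t p| <= `|G p| * `|s - t|.
  exact: (is_derive_Rintegral mW epos iwater iG' lipW is_derive_water).
case: p => x z st Wp; have Op := subW Wp; have [Ax /= /andP[bz zs]] := Op.
have phi0 : 0 < phi D x z.
  by case: hD => _ _ /(_ x z Op)/andP[].
rewrite /water /= -mulrBr normrM gtr0_norm// mulrC -ler_pdivlMr// mulrAC.
have M0 : 0 <= `|G (x, z)| / phi D x z by rewrite divr_ge0// ltW.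
have lip a b : a <= b -> `|a - t| < eps -> `|b - t| < eps ->
    `|sat_P b x z - sat_P a x z| <= `|G (x, z)| / phi D x z * (b - a).
  move=> ab at' bt.
  have inside r : a <= r <= b -> `|r - t| < eps.
    by move=> /andP[ar rb]; move: at' bt; rewrite !ltr_norml; lra.
  apply: (@lipschitz_off_contact _ (fun r => sat_P r x z) (h ^~ x) a b 1 z) => //.
  - by move=> r; rewrite in_itv/= => /inside /near_t[rT _]; exact: csat.
  - by move=> r; rewrite in_itv/= => /inside /near_t[rT _]; exact: ch_time.
  - by move=> r /inside /near_t[rT _] zr; exact: saturated.
  - move=> r /inside /near_t[rT rt] rz.
    have Opr : Omega_plus D sol r (x, z) by split.
    split; first by have [] := dP r x z rT Opr.
    have := dom r x z rt rT Opr; rewrite normrM gtr0_norm// => hG.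
    by rewrite ler_pdivlMr// mulrC (le_trans hG)// ler_norm.
have [ts|st'] := leP t s.
  rewrite [`|s - t|]ger0_norm ?subr_ge0//; apply: lip => //.
  by rewrite subrr normr0.
rewrite distrC [`|s - t|]ltr0_norm ?subr_lt0// opprB; apply: lip => //.
  exact: ltW.
by rewrite subrr normr0.
Qed.

Let is_derive_mass :
  is_derive t 1 (M_tot D sol) (rho D * \int[lambda3 R]_(p in plus) rate p).
Proof.
have [irate dW] := leibniz.
have E : \int[lambda3 R]_(p in plus `|` minus) rate p =
    \int[lambda3 R]_(p in plus) rate p.
  rewrite Rintegral_setU//; last exact: disjoint_bands.
  rewrite [X in _ + X](_ : _ = 0) ?addr0//.
  rewrite (_ : \int[lambda3 R]_(p in minus) rate p = \int[lambda3 R]_(p in minus) 0).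
    by rewrite Rintegral_cst// mul0r.
  by apply: eq_Rintegral => p /set_mem pm; rewrite /rate dt_sat_minus// mulr0.
have dc : is_derive t 1
    (fun s => rho D *: \int[lambda3 R]_(p in plus `|` minus) water s p : R)
    (rho D *: \int[lambda3 R]_(p in plus `|` minus) rate p).
  by apply: is_derive_eq.
have nearM : \forall s \near t,
    rho D *: \int[lambda3 R]_(p in plus `|` minus) water s p = M_tot D sol s.
  near=> s.
  have sT : 0 < s < T.
    by apply/andP; split; near: s; [exact: lt_nbhsr|exact: lt_nbhsl].
  have [iw ->] := water_mass sT.
  by rewrite (Rintegral_bandU oA chb chs (ch ht0) bh hle iw).
by rewrite -E; exact: near_eq_is_derive nearM dc.
Unshelve. all: by end_near. Qed.

Lemma mass_balance : is_derive t 1 (M_tot D sol)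
  (- rho D * (\int[lambda2 R]_(x in A) uz_soil D sol t x)).
Proof.
have [irate _] := leibniz.
have iplus : (lambda3 R).-integrable plus (EFin \o rate).
  by apply: (integrableS mW mplus _ irate) => p; left.
have [_ _ regu rflux' _] := hreg.
have [[mass _ _ _] _ [div_above _ _] _ _] := hsol.
have dg x z : A x -> h t x < z < hs x ->
    derivable (uz sol t x) z 1 /\
    phi D x z * dt_sat D sol t x z + derive1 (uz sol t x) z = 0.
  move=> Ax hz; have [du _ _ _] := regu t x ht Ax; split; first exact: du.
  by apply: mass => //; rewrite (Omega_plusE ht0).
have cg x : A x -> {in `]h t x, hs x[, continuous (derive1 (uz sol t x))}.
  by move=> Ax; have [_ cu _ _] := regu t x ht Ax.
have above x : A x -> uz sol t x @ (h t x)^'+ --> uz_above sol t x.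
  by move=> Ax; have [_ _ + _] := regu t x ht Ax.
have soil x : A x -> uz sol t x @ (hs x)^'- --> uz_soil D sol t x.
  by move=> Ax; have [_ _ _] := regu t x ht Ax.
have [iflux Iflux] := Rintegral_column_flux oA (ch ht0) chs hlt iplus dg cg above soil.
have idiv : (lambda2 R).-integrable A (EFin \o div_x (flux D sol t)).
  by have [] := rflux' t ht.
have -> : - rho D * (\int[lambda2 R]_(x in A) uz_soil D sol t x) =
    rho D * \int[lambda3 R]_(p in plus) rate p; last exact: is_derive_mass.
rewrite (_ : \int[lambda2 R]_(x in A) uz_soil D sol t x =
    \int[lambda2 R]_(x in A) ((uz_soil D sol t x - uz_above sol t x) +
      div_x (flux D sol t) x)).
  by rewrite RintegralD// Iflux Rintegral_div_flux// addr0 mulrNN.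
apply: eq_Rintegral => x /set_mem Ax.
by rewrite (div_above t x ht Ax) subrK.
Qed.
End TimeDerivative.

End CoupledModel.

Theorem proposition3p1 (R : realType) (D : data R) (sol : unknowns R)
    (hD : data_ok D) (hsol : solution D sol) (hreg : sufficiently_regular D sol)
    (t : R) (ht : 0 < t < T_end D) :
  is_derive t 1 (M_tot D sol)
    (- rho D * (\int[lambda2 R]_(x in Omega_x D) uz_soil D sol t x)).
Proof. exact: mass_balance. Qed.
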